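(* Let $h$ be a gauge function, let $w$ be a non-negative function in $L^1(\mathbb{T}, |dz|)$, and let $t, \epsilon \in (0,\infty)$. Suppose that \[ \int_E \log w \, |dz| = -\infty \] for every $h$-Carleson set $E \subset \mathbb{T}$ of positive Lebesgue measure. Then there exists a sequence $\{p_N\}_N$ of polynomials in the complex variable $z$ with complex coefficients such that (i) $p_N \to 0$ in the topology of $L^t(w\,|dz|)$, i.e. $\int_{\mathbb{T}} |p_N|^t w \, |dz| \to 0$; (ii) $p_N \to 1$ uniformly on compact subsets of $\mathbb{D}$; (iii) $|p_N(z)| \leq \exp\Big( \epsilon \frac{h(1-|z|)}{1-|z|} \Big)$ for all $z \in \mathbb{D}$ and all $N$.
   Context: $\mathbb{D} = \{z \in \mathbb{C} : |z|<1\}$, $\mathbb{T} = \partial \mathbb{D}$, and $|dz|$ is the arclength (Lebesgue) measure on $\mathbb{T}$. The convention $\log 0 = -\infty$ is used. A gauge function is a continuous increasing function $h$ defined on $[0,\infty)$ with $h(0)=0$, which satisfies: $h(x)/x$ is decreasing in $x$, and $\lim_{x \to 0} h(x)/x = \infty$. (Monotonicity is understood in the non-strict sense.) A closed set $E \subset \mathbb{T}$ is an $h$-Carleson set if the family $\{I_k\}_k$ of maximal disjoint open arcs complementary to $E$ in $\mathbb{T}$ (the connected components of $\mathbb{T}\setminus E$) satisfies $\sum_k h(|I_k|) < \infty$, where $|I_k|$ is the arclength of $I_k$. *)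

(* Defs.v *)
From HB Require Import structures.
From mathcomp Require Import all_boot all_order all_algebra.
From mathcomp Require Import complex.
From mathcomp Require Import all_classical all_reals all_analysis.

Set Implicit Arguments.
Unset Strict Implicit.
Unset Printing Implicit Defensive.

Import Order.TTheory GRing.Theory Num.Theory.
Import numFieldNormedType.Exports.
Import ComplexField.

Local Open Scope classical_set_scope.
Local Open Scope ring_scope.
Local Open Scope complex_scope.

(* The library attaches the norm topology to [R[i]^o], not to [R[i]].  The norm
   [`|z|] of a complex number is itself an element of [R[i]]; the real-valued
   modulus is [Normc.normc z]. *)

Definition circle (R : realType) : set (R[i])^o := [set z | Normc.normc z = 1].
Arguments circle : clear implicits.

Definition disk (R : realType) : set (R[i])^o := [set z | Normc.normc z < 1].
Arguments disk : clear implicits.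

Definition borelC (R : realType) := g_sigma_algebraType (@open (R[i])^o).

Definition expi (R : realType) (x : R) : borelC R := cos x +i* sin x.

Lemma continuous_expi (R : realType) : continuous (@expi R : R -> (R[i])^o).
Proof.
have le_norm (a b : R) : `|a +i* b| <= (`|a| + `|b|)%:C.
  have -> : a +i* b = a%:C + 'i * b%:C by simpc.
  apply: (le_trans (ler_normD _ _)).
  have normi : `|'i%C| = 1 :> R[i].
    by rewrite normc_def /= expr0n expr1n add0r sqrtr1.
  by rewrite normrM normi mul1r !normc_def /= expr0n !addr0 !sqrtr_sqr rmorphD.
move=> x; apply/cvgrPdist_lt => e e0.
have eE : e = (complex.Re e)%:C by apply/esym/RRe_real/gtr0_real.
have re0 : 0 < complex.Re e by move: e0; rewrite {1}eE ltcR.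
have e2 : 0 < complex.Re e / 2 by rewrite divr_gt0.
have /cvgrPdist_lt/(_ _ e2) hc := @continuous_cos R x.
have /cvgrPdist_lt/(_ _ e2) hs := @continuous_sin R x.
near=> y.
have -> : (expi x : R[i]) - expi y = (cos x - cos y) +i* (sin x - sin y) by [].
apply: (le_lt_trans (le_norm _ _)); rewrite eE ltcR [ltRHS]splitr ltrD//.
- by near: y.
- by near: y.
Unshelve. all: by end_near. Qed.

Lemma measurable_expi (R : realType) : measurable_fun [set: R] (@expi R).
Proof.
have sub : preimage_set_system [set: R] (@expi R) (@open (R[i])^o)
    `<=` measurable.
  move=> _ [A oA <-]; rewrite setTI; apply: measurable_realfun.open_measurable.
  by have /continuousP := @continuous_expi R; apply.
exact: (@measurability _ _ _ (borelC R) _ _ _ erefl sub).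
Qed.

HB.instance Definition _ (R : realType) :=
  isMeasurableFun.Build _ _ _ _ (@expi R) (@measurable_expi R).

(* Arclength measure on the circle, as a measure on the plane: the image of
   Lebesgue measure on [0, 2 pi[ under x |-> exp (i x). *)
Definition arclength (R : realType) : set (borelC R) -> \bar R :=
  pushforward
    (mrestr (@lebesgue_measure R) (measurable_itv `[0 : R, 2 * pi[)) (@expi R).
Arguments arclength : clear implicits.

Section arclength_measure.
Variable R : realType.

Let arclength0 : arclength R set0 = 0%E.
Proof. by rewrite /arclength measure0 //; exact: measurable_expi. Qed.

Let arclength_ge0 A : (0 <= arclength R A)%E.
Proof. by apply: measure_ge0; exact: measurable_expi. Qed.

Let arclength_sigma_additive : semi_sigma_additive (arclength R).
Proof. by apply: measure_semi_sigma_additive; exact: measurable_expi. Qed.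

HB.instance Definition _ := isMeasure.Build _ _ _ (arclength R)
  arclength0 arclength_ge0 arclength_sigma_additive.

End arclength_measure.

Definition gauge_function (R : realType) (h : R -> R) : Prop :=
  [/\ {within `[0, +oo[, continuous h},
      forall x y : R, 0 <= x -> x <= y -> h x <= h y,
      h 0 = 0,
      forall x y : R, 0 < x -> x <= y -> h y / y <= h x / x &
      h x / x @[x --> 0^'+] --> +oo].

Definition complementary_arcs (R : realType) (E : set (R[i])^o)
    : set (set (R[i])^o) :=
  [set connected_component (circle R `\` E) z | z in circle R `\` E].

Definition carleson_set (R : realType) (h : R -> R) (E : set (R[i])^o) : Prop :=
  [/\ closed E, E `<=` circle R &
      (\esum_(I in complementary_arcs E)
         (h (fine (arclength R I)))%:E < +oo)%E].

(* Main.v *)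
Require Import Defs.
From HB Require Import structures.
From mathcomp Require Import all_boot all_order all_algebra.
From mathcomp Require Import complex.
From mathcomp Require Import all_classical all_reals all_analysis.
From mathcomp Require Import finmap measurable_realfun.
From mathcomp Require Import ring lra zify.

Set Implicit Arguments.
Unset Strict Implicit.
Unset Printing Implicit Defensive.

Import Order.TTheory GRing.Theory Num.Theory.
Import numFieldNormedType.Exports.
Import ComplexField.

Local Open Scope classical_set_scope.
Local Open Scope ring_scope.
Local Open Scope complex_scope.

(** Identify the circle with [0, 2 pi) and cut it dyadically. Let b l = e h(a)/a, where a is the
    length of a cell of level l. Take t = 1 for simplicity (in general f and M are divided by t).
    Suppose a step function f >= 0 has mean exactly M on every cell of a coarse level n0, mean at
    most b l on every finer cell of level l, and the integral of exp(f) w bounded independently of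
    M. Then the exponential of the Herglotz integral of f - M has modulus about exp(f - M) on the
    circle, hence is small in the weighted norm. It is close to 1 inside the disk, because f - M has
    mean zero on short cells. Harnack's inequality at the scale 1 - |z| turns the bounds on the
    means into the growth bound ([flow_polynomial]). Finally M tends to infinity.

    Such an f is a flow down the dyadic tree ([flow]): every cell may carry mean at most b l, and a
    final cell at most about the positive part of -log of the mean of w ([leaf]). The largest mean
    that a cell can carry is its [capacity], which grows with the depth of the tree. Everything
    reduces to showing that the limit capacity of each cell is its own cap ([all_saturated]): then
    any M < b n0 can be sent down from all cells of level n0 at once ([flow_capacity]).

    This is where the hypothesis on w enters. Starting at level n0, stop at the first saturated
    cells. A stopped cell of length a uses up e h(a) of the total limit capacity, which is finite,
    so the complement E of the open stopped arcs is an h-Carleson set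
    ([carleson_stopped_complement]). Almost everywhere on E no cell stops the descent, the leaf
    values converge to the positive part of -log w by Lebesgue differentiation, and Fatou's lemma
    makes this limit integrable over E. Hence E has measure zero ([stopped_complement_null]). The
    stopped cells therefore fill the circle up to a null set, and as b is nondecreasing their caps
    add up to capacity b n0 for each cell of level n0.

    To obtain polynomials, the integral becomes a sum over equispaced nodes, the Herglotz kernel its
    Taylor polynomial, and exp(g) the power (1 + g/K)^K ([poisson_mean_le], [exponent_small],
    [power_poly_bounds]). The boundary estimate is lost only near the endpoints of cells, where the
    modulus stays bounded and w has little mass ([near_weight_small]). [stage] combines the
    estimates. *)

Lemma sum_dyadic_split (R : realType) (F : nat -> R) (d k : nat) :
  \sum_(j < 2 ^ d.+1) F (k * 2 ^ d.+1 + j)%N =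
  \sum_(j < 2 ^ d) F (k.*2 * 2 ^ d + j)%N +
  \sum_(j < 2 ^ d) F (k.*2.+1 * 2 ^ d + j)%N.
Proof.
rewrite -!(big_mkord xpredT (fun j => F (_ + j)%N)).
have le1 : (2 ^ d <= 2 ^ d.+1)%N by rewrite leq_exp2l.
rewrite (big_cat_nat (leq0n _) le1)/=; congr (_ + _).
  by apply: eq_bigr => i _; congr F; rewrite expnS -muln2; ring.
have e : (2 ^ d.+1)%N = (2 ^ d + 2 ^ d)%N by rewrite expnS; ring.
rewrite {1}e -{1}(add0n (2 ^ d)%N) big_addn addnK.
by apply: eq_bigr => i _; congr F; rewrite expnS -muln2; ring.
Qed.

(** * Capacities, traces and flows on the dyadic tree *)

Section Tree.
Variables (R : realType) (b : nat -> R) (v : nat -> nat -> R).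

(** The max-flow value of a tree of depth [d], normalised as a mean: the most that node [k] of level
    [l] can carry when nodes of level l' above the leaves are capped by [b l'] and the leaves, at
    level [l + d], by [v]. *)
Fixpoint capacity d l k : R :=
  if d is d'.+1 then
    Num.min (b l)
      ((capacity d' l.+1 k.*2 + capacity d' l.+1 k.*2.+1) / 2)
  else v l k.

Definition limit_capacity l k : R := limn (fun d => capacity d l k).

Definition saturated l k := limit_capacity l k == b l.

(* The index [k] of [trace d l k] is that of a node of level [l + d]: the
   value is read off at the first saturated ancestor of level at least [l]. *)
Fixpoint trace d l k : R :=
  if saturated l (k %/ 2 ^ d) then b l
  else if d is d'.+1 then trace d' l.+1 k else v l k.

Hypothesis v_ge0 : forall l k, 0 <= v l k.
Hypothesis v_le : forall l k, v l k <= b l.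
Hypothesis v_avg : forall l k, v l k <= (v l.+1 k.*2 + v l.+1 k.*2.+1) / 2.

Lemma capacity_le d l k : capacity d l k <= b l.
Proof. by case: d => [|d] /=; [exact: v_le | rewrite ge_min lexx]. Qed.

Lemma capacity_ge0 d l k : 0 <= capacity d l k.
Proof.
elim: d l k => [|d IH] l k /=; first exact: v_ge0.
by rewrite le_min (le_trans (v_ge0 l k) (v_le l k)) divr_ge0// addr_ge0.
Qed.

(** A leaf value is at most both the cap of its node and the mean of the two leaf values below it,
    so splitting all leaves once more loses nothing. *)
Lemma capacity_leS d l k : capacity d l k <= capacity d.+1 l k.
Proof.
elim: d l k => [|d IH] l k.
  by rewrite /= le_min v_le v_avg.
rewrite [leRHS]/= [leLHS]/= le_min ge_min lexx/= ge_min; apply/orP; right.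
by rewrite ler_pM2r ?invr_gt0// lerD// IH.
Qed.

Lemma capacity_nd l k : nondecreasing_seq (fun d => capacity d l k).
Proof. by apply/nondecreasing_seqP => d; exact: capacity_leS. Qed.

Lemma capacity_cvg l k :
  (fun d => capacity d l k) @ \oo --> limit_capacity l k.
Proof.
apply: nondecreasing_is_cvgn; first exact: capacity_nd.
by exists (b l) => _ [d _ <-]; exact: capacity_le.
Qed.

Lemma capacity_le_limit d l k : capacity d l k <= limit_capacity l k.
Proof.
apply: (@nondecreasing_cvgn_le _ (fun d => capacity d l k)).
  exact: capacity_nd.
exact: (cvgP _ (@capacity_cvg l k)).
Qed.

Lemma limit_capacity_le l k : limit_capacity l k <= b l.
Proof.
apply: limr_le; first exact: (cvgP _ (@capacity_cvg l k)).
by near=> d; exact: capacity_le.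
Unshelve. all: by end_near. Qed.

Lemma limit_capacity_ge0 l k : 0 <= limit_capacity l k.
Proof. by rewrite (le_trans _ (capacity_le_limit 0 l k))//; exact: v_ge0. Qed.

(** If the cap is not reached in the limit, it is not reached at any finite depth, so the minimum is
    always the mean of the children; this identity passes to the limit. *)
Lemma limit_capacity_avg l k : ~~ saturated l k ->
  (limit_capacity l.+1 k.*2 + limit_capacity l.+1 k.*2.+1) / 2
    = limit_capacity l k.
Proof.
move=> ns; have lt : limit_capacity l k < b l.
  by rewrite lt_neqAle ns limit_capacity_le.
have E d : (capacity d l.+1 k.*2 + capacity d l.+1 k.*2.+1) / 2
    = capacity d.+1 l k.
  apply/esym/min_idPr; have := le_lt_trans (capacity_le_limit d.+1 l k) lt.
  by rewrite /= gt_min ltxx/= => /ltW.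
have h1 : (fun d => capacity d.+1 l k) @ \oo --> limit_capacity l k.
  by have := @capacity_cvg l k; rewrite -(cvg_shiftS (fun d => capacity d l k)).
rewrite -(cvg_lim (@Rhausdorff R) h1); apply/esym/(cvg_lim (@Rhausdorff R)).
rewrite -(funext E); apply: cvgM; last exact: cvg_cst.
by apply: cvgD; exact: capacity_cvg.
Qed.

(** Mass balance: an unsaturated node splits its limit capacity exactly between its children, a
    saturated one is where the trace stops with the value [b l], and a leaf value never exceeds the
    limit capacity. *)
Lemma sum_trace_le d l k :
  \sum_(j < 2 ^ d) trace d l (k * 2 ^ d + j)%N <= 2 ^+ d * limit_capacity l k.
Proof.
elim: d l k => [|d IH] l k.
  rewrite expn0 big_ord1 expr0 mul1r /= muln1 addn0 divn1.
  by case: ifPn => [/eqP->//|_]; exact: (capacity_le_limit 0).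
have [s|ns] := boolP (saturated l k).
  rewrite (eq_bigr (fun=> b l)); last first.
    move=> j _ /=; rewrite divnMDl ?expn_gt0// (divn_small (ltn_ord j)) addn0.
    by rewrite s.
  by rewrite sumr_const card_ord (eqP s) -natrX mulr_natl.
have -> : \sum_(j < 2 ^ d.+1) trace d.+1 l (k * 2 ^ d.+1 + j)%N =
    \sum_(j < 2 ^ d.+1) trace d l.+1 (k * 2 ^ d.+1 + j)%N.
  apply: eq_bigr => j _.
  rewrite /= divnMDl ?expn_gt0// (divn_small (ltn_ord j)) addn0.
  by rewrite (negbTE ns).
rewrite sum_dyadic_split -(limit_capacity_avg ns) exprS.
have -> (x y z : R) : 2 * x * ((y + z) / 2) = x * y + x * z by field.
by rewrite lerD.
Qed.

Lemma trace_ge0 d l k : 0 <= trace d l k.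
Proof.
elim: d l k => [|d IH] l k /=; case: ifP => // _.
- exact: le_trans (v_ge0 l k) (v_le l k).
- exact: le_trans (v_ge0 l k) (v_le l k).
Qed.

Section Flow.
Variables (n0 D : nat) (M : R).

Let cap e k := capacity (D - e) (n0 + e) k.

(* Splits the mass [M] of a node of level [n0] proportionally to the capacities
   of the two children, down to the level [n0 + D], and evenly below it. *)
Fixpoint flow e k : R :=
  if e is e'.+1 then
    flow e' k./2 *
    (if (e' < D)%N then
       cap e k / ((cap e (k./2).*2 + cap e (k./2).*2.+1) / 2)
     else 1)
  else M.

Hypothesis M_ge0 : 0 <= M.
Hypothesis M_le : forall k, (k < 2 ^ n0)%N -> M <= capacity D n0 k.

Lemma flow_ge0 e k : 0 <= flow e k.
Proof.
elim: e k => [|e IH] k //=; rewrite mulr_ge0//; case: ifP => // _.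
have cap0 e' k' : 0 <= cap e' k' by exact: capacity_ge0.
by rewrite !divr_ge0// addr_ge0.
Qed.

(** The flow at the parent is at most the mean [s] of the capacities of the children, so each child
    receives a fraction at most 1 of its own capacity. *)
Lemma flow_le_cap e k : (e <= D)%N -> (k < 2 ^ (n0 + e))%N ->
  flow e k <= cap e k.
Proof.
elim: e k => [|e IH] k eD kn; first by rewrite /cap subn0 addn0 M_le// -(addn0 n0).
rewrite /= eD.
have k2 : (k./2 < 2 ^ (n0 + e))%N.
  by rewrite -divn2 ltn_divLR// -expnSr -addnS.
have := IH _ (ltnW eD) k2.
have -> : cap e k./2 = Num.min (b (n0 + e))
    ((cap e.+1 (k./2).*2 + cap e.+1 (k./2).*2.+1) / 2).
  by rewrite /cap -(subnSK eD) /= addnS.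
set s := (_ + _) / 2.
rewrite le_min => /andP[_ fs].
have c0 : 0 <= cap e.+1 k by exact: capacity_ge0.
have s0 : 0 <= s by rewrite divr_ge0// addr_ge0//; exact: capacity_ge0.
(* Children without capacity: the inverse of 0 is 0, so they receive no flow. *)
have [z|nz] := eqVneq s 0.
  by rewrite z invr0 !mulr0.
have sp : 0 < s by rewrite lt_neqAle eq_sym nz.
by rewrite mulrA ler_pdivrMr// mulrC ler_wpM2l.
Qed.

(** Conservation of mass. When both children have capacity 0, the bound by the capacity forces the
    flow at the parent to be 0 as well. *)
Lemma flow_avg e k : (k < 2 ^ (n0 + e))%N ->
  flow e.+1 k.*2 + flow e.+1 k.*2.+1 = 2 * flow e k.
Proof.
move=> kn; rewrite /= doubleK uphalf_double; case: ifPn => eD; last by ring.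
set x := cap _ _; set y := cap _ _; have := flow_le_cap (ltnW eD) kn.
have -> : cap e k = Num.min (b (n0 + e)) ((x + y) / 2).
  by rewrite /x /y /cap -(subnSK eD) /= addnS.
rewrite le_min => /andP[_ fs].
have [z|nz] := eqVneq (x + y) 0; last by field.
have -> : flow e k = 0.
  by apply/eqP; rewrite eq_le flow_ge0 andbT; move: fs; rewrite z mul0r.
by rewrite !mul0r mulr0 addr0.
Qed.


End Flow.
End Tree.

(** * Modulus, real part and unit exponentials of complex numbers *)

Local Notation normc := Normc.normc.

Section ComplexModulus.
Variable R : realType.
Implicit Types (z q : R[i]) (x y : R).

Lemma normc_sqr z : normc z ^+ 2 = complex.Re z ^+ 2 + complex.Im z ^+ 2.
Proof. by case: z => a b /=; rewrite sqr_sqrtr// addr_ge0// sqr_ge0. Qed.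

Lemma normc_ge0 z : 0 <= normc z.
Proof. by case: z => a b /=; exact: sqrtr_ge0. Qed.

Lemma normr_normc z : `|z| = (normc z)%:C.
Proof. by []. Qed.

Lemma normcX z n : normc (z ^+ n) = normc z ^+ n.
Proof. by apply: complexI; rewrite -normr_normc normrX normr_normc rmorphXn. Qed.

Lemma normc_sum_le (I : finType) (F : I -> R[i]) :
  normc (\sum_i F i) <= \sum_i normc (F i).
Proof.
elim/big_ind2 : _ => [|x1 x2 y1 y2 h1 h2|//]; first by rewrite Normc.normc0.
by rewrite (le_trans (le_normcD _ _))// lerD.
Qed.

Lemma normcR x : normc x%:C = `|x|.
Proof. by rewrite /= expr0n addr0 sqrtr_sqr. Qed.

Lemma normcB_sym z q : normc (z - q) = normc (q - z).
Proof. by rewrite -normcN opprB. Qed.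

Lemma normc_distr_ge z q : normc z - normc q <= normc (z - q).
Proof. by rewrite lerBlDr -{1}(subrK q z) le_normcD. Qed.

Lemma Re_le_normc z : `|complex.Re z| <= normc z.
Proof.
rewrite -(ler_pXn2r (ltn0Sn 1)) ?nnegrE ?normc_ge0//.
by rewrite normc_sqr real_normK ?num_real// lerDl sqr_ge0.
Qed.

Lemma normc_le_ReIm x y : normc (x +i* y) <= `|x| + `|y|.
Proof.
rewrite -(ler_pXn2r (ltn0Sn 1)) ?nnegrE ?normc_ge0// ?addr_ge0//.
rewrite normc_sqr /= -[x ^+ 2]real_normK ?num_real//.
by rewrite -[y ^+ 2]real_normK ?num_real// sqrrD addrAC lerDl mulrn_wge0// mulr_ge0.
Qed.

Lemma ReD z q : complex.Re (z + q) = complex.Re z + complex.Re q.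
Proof. by case: z q => ? ? []. Qed.

Lemma Re_sum (I : finType) (F : I -> R[i]) :
  complex.Re (\sum_i F i) = \sum_i complex.Re (F i).
Proof. by elim/big_ind2 : _ => // z x q y <- <-; rewrite ReD. Qed.

Lemma Re_scale x z : complex.Re (x%:C * z) = x * complex.Re z.
Proof. by case: z => a b /=; rewrite mul0r subr0. Qed.

Definition cis x : R[i] := cos x +i* sin x.

Lemma cisD x y : cis (x + y) = cis x * cis y.
Proof. by rewrite /cis cosD sinD; simpc; congr (_ +i* _); ring. Qed.

Lemma cis0 : cis 0 = 1.
Proof. by rewrite /cis cos0 sin0. Qed.

Lemma normc_cis x : normc (cis x) = 1.
Proof. by rewrite /= cos2Dsin2 sqrtr1. Qed.

Lemma cisMn x n : cis (x *+ n) = cis x ^+ n.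
Proof.
by elim: n => [|n IH]; rewrite ?mulr0n ?cis0// mulrS cisD IH exprS.
Qed.

Lemma cis2pi : cis (2 * pi) = 1.
Proof. by rewrite mulr_natl /cis cos2pi sin2pi. Qed.

Lemma cis_neq1 x : 0 < x < 2 * pi -> cis x != 1.
Proof.
move=> /andP[x0 x2]; apply/eqP => -[c1 _].
have hp := @pi_gt0 R.
have [xp|xp] := leP x pi.
  have := @ltr_cos R 0 x; rewrite !in_itv/= lexx xp pi_ge0 (ltW x0)/=.
  by move=> /(_ isT isT); rewrite cos0 c1 ltxx x0.
have := @ltr_cos R 0 (2 * pi - x); rewrite !in_itv/= lexx pi_ge0/=.
have -> : 0 <= 2 * pi - x <= pi by lra.
move=> /(_ isT isT); rewrite cos0 cosB [2 * pi]mulr_natl cos2pi sin2pi c1.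
by rewrite mulr1 mul0r addr0 ltxx -mulr_natl subr_gt0 x2.
Qed.

Lemma normc_cisB_le x y : normc (cis x - cis y) <= 2 * `|x - y|.
Proof.
wlog xy : x y / x < y => [H|].
  have [/H//|/H|->] := ltgtP x y; last by rewrite !subrr normr0 mulr0 Normc.normc0.
  by rewrite normcB_sym distrC.
have aux (f g : R -> R) : (forall s : R, is_derive s 1 f (g s)) ->
    (forall s, `|g s| <= 1) -> `|f x - f y| <= `|x - y|.
  move=> df g1.
  have cf : {within `[x, y], continuous f}.
    by apply: derivable_within_continuous => s _; have [] := df s.
  have [c _ E] := MVT xy (fun s _ => df s) cf.
  by rewrite distrC E normrM [leRHS]distrC -[leRHS]mul1r ler_wpM2r.
have -> : cis x - cis y = (cos x - cos y) +i* (sin x - sin y) by [].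
rewrite (le_trans (normc_le_ReIm _ _))// mulr_natl mulr2n lerD//.
- apply: (aux (@cos R) (fun s => - sin s)) => s.
  by rewrite normrN sin_max.
- by apply: (aux (@sin R) (@cos R)) => s; exact: cos_max.
Qed.

End ComplexModulus.

(** * Herglotz and Poisson kernels, and their truncation *)

Section Herglotz.
Variable R : realType.
Implicit Types (z q a : R[i]) (r x : R).

Definition herglotz q : R[i] := (1 + q) / (1 - q).

(** The Poisson kernel of z at a boundary point a, as a function of q = z conj(a). *)
Definition poisson q : R := (1 - normc q ^+ 2) / normc (1 - q) ^+ 2.

(** The Taylor polynomial of [herglotz] with the terms of degree below n, for n >= 1. *)
Definition herglotz_trunc n q : R[i] := 1 + 2 * \sum_(1 <= m < n) q ^+ m.

Definition trunc_error n r : R := 2 * r ^+ n / (1 - r).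

Lemma normc_1B_ge q r : normc q <= r -> 1 - r <= normc (1 - q).
Proof.
move=> qr; rewrite (le_trans _ (normc_distr_ge _ _))// Normc.normc1.
by rewrite lerB.
Qed.

Lemma subr1_neq0 q : normc q < 1 -> 1 - q != 0.
Proof.
move=> q1; apply/eqP => e; have := normc_1B_ge (lexx (normc q)).
by rewrite e Normc.normc0 leNgt subr_gt0 q1.
Qed.

Lemma Re_herglotz q : normc q < 1 -> complex.Re (herglotz q) = poisson q.
Proof.
move=> q1; have := subr1_neq0 q1; rewrite /herglotz /poisson !normc_sqr.
case: q q1 => a b _ /=; rewrite eq_complex /= negb_and => nz.
have nz' : (1 - a) ^+ 2 + (0 - b) ^+ 2 != 0.
  rewrite paddr_eq0 ?sqr_ge0// !sqrf_eq0 negb_and.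
  exact: nz.
by move: nz'; set D := _ + _ => nz'; field.
Qed.

Lemma poisson_ge0 q : normc q <= 1 -> 0 <= poisson q.
Proof.
by move=> q1; rewrite divr_ge0 ?sqr_ge0// subr_ge0 exprn_ile1 ?normc_ge0.
Qed.

Lemma herglotz_trunc_error n q r : (0 < n)%N -> normc q <= r -> r < 1 ->
  normc (herglotz_trunc n q - herglotz q) <= trunc_error n r.
Proof.
move=> n0 qr r1; have nz := subr1_neq0 (le_lt_trans qr r1).
have r0 : 0 <= r := le_trans (normc_ge0 q) qr.
have E : herglotz_trunc n q - herglotz q = - 2 * q ^+ n / (1 - q).
  rewrite /herglotz_trunc /herglotz; apply: (mulIf nz); rewrite mulrBl !divfK//.
  case: n n0 => // n _; elim: n => [|n IH].
    by rewrite big_geq// mulr0 expr1; ring.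
  rewrite big_nat_recr//=; move: IH; set S := \sum_(_ <= _ < _) _ => IH.
  have -> : (1 + 2 * (S + q ^+ n.+1)) * (1 - q) - (1 + q)
     = ((1 + 2 * S) * (1 - q) - (1 + q)) + 2 * q ^+ n.+1 * (1 - q) by ring.
  by rewrite IH (exprS q n.+1); ring.
rewrite E !Normc.normcM normcN normcX Normc.normcV.
have -> : normc (2 : R[i]) = 2.
  by have := @normcR R 2; rewrite rmorph_nat ger0_norm.
have d0 : 0 < 1 - r by rewrite subr_gt0.
rewrite /trunc_error ler_pM//.
- by rewrite mulr_ge0// exprn_ge0// normc_ge0.
- by rewrite invr_ge0 normc_ge0.
- by rewrite ler_pM2l// lerXn2r// ?nnegrE ?normc_ge0.
- by rewrite lef_pV2 ?posrE// ?normc_1B_ge// (lt_le_trans d0)// normc_1B_ge.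
Qed.

Lemma herglotzB_le q q' r : normc q <= r -> normc q' <= r -> r < 1 ->
  normc (herglotz q - herglotz q') <= 2 * normc (q - q') / (1 - r) ^+ 2.
Proof.
move=> qr qr' r1; have nz := subr1_neq0 (le_lt_trans qr r1).
have nz' := subr1_neq0 (le_lt_trans qr' r1).
have -> : herglotz q - herglotz q' = 2 * (q - q') / ((1 - q) * (1 - q')).
  by rewrite /herglotz; field; rewrite nz nz'.
have d0 : 0 < 1 - r by rewrite subr_gt0.
rewrite !Normc.normcM Normc.normcV Normc.normcM.
have -> : normc (2 : R[i]) = 2.
  by have := @normcR R 2; rewrite rmorph_nat ger0_norm.
have p1 := lt_le_trans d0 (normc_1B_ge qr).
have p2 := lt_le_trans d0 (normc_1B_ge qr').
rewrite ler_wpM2l ?mulr_ge0 ?normc_ge0// lef_pV2 ?posrE ?exprn_gt0 ?mulr_gt0//.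
by rewrite expr2 ler_pM ?(ltW d0)// normc_1B_ge.
Qed.

(* Harnack's inequality. *)
Lemma poisson_le q q' : normc q' = normc q -> normc q < 1 ->
  poisson q <= (1 + normc (q - q') / (1 - normc q)) ^+ 2 * poisson q'.
Proof.
move=> e q1; rewrite /poisson e mulrCA ler_wpM2l//.
  by rewrite subr_ge0 exprn_ile1// ?normc_ge0// ltW.
have d0 : 0 < 1 - normc q by rewrite subr_gt0.
have p1 := lt_le_trans d0 (normc_1B_ge (lexx (normc q))).
have p2 : 0 < normc (1 - q').
  by rewrite (lt_le_trans d0)// normc_1B_ge// e.
rewrite -!exprVn -exprMn lerXn2r ?nnegrE ?invr_ge0 ?normc_ge0//.
  by rewrite mulr_ge0 ?invr_ge0 ?normc_ge0// addr_ge0// divr_ge0 ?normc_ge0// ltW.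
rewrite ler_pdivlMr// mulrC ler_pdivrMr// mulrDl mul1r.
have -> : 1 - q' = (1 - q) + (q - q') by ring.
rewrite (le_trans (le_normcD _ _))// lerD2l.
by rewrite mulrAC ler_pdivlMr// ler_wpM2l ?normc_ge0// normc_1B_ge.
Qed.

Lemma sum_rootX n m : (0 < m < n)%N ->
  \sum_(i < n) cis (- (2 * pi * i%:R / n%:R) : R) ^+ m = 0.
Proof.
move=> /andP[m0 mn]; have n0 : (0 < n)%N by rewrite (leq_ltn_trans _ mn).
have nR : (0 : R) < n%:R by rewrite ltr0n.
have p0 : (0 : R) < pi := pi_gt0 R.
set w := cis (- (2 * pi * m%:R / n%:R) : R).
have E i : cis (- (2 * pi * i%:R / n%:R) : R) ^+ m = w ^+ i.
  rewrite /w -!cisMn; congr cis; rewrite -(mulr_natr (- _) m) -(mulr_natr (- _) i).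
  by field; rewrite gt_eqF.
rewrite (eq_bigr (fun i : 'I_n => w ^+ i)) => [|i _]; last exact: E.
have w1 : w != 1.
  have := @cis_neq1 R (2 * pi - 2 * pi * m%:R / n%:R).
  rewrite cisD cis2pi mul1r; apply.
  rewrite subr_gt0 ltr_pdivrMr// ltr_pM2l ?mulr_gt0// ltr_nat mn/=.
  by rewrite gtrBl divr_gt0// !mulr_gt0// ltr0n.
have wn : w ^+ n = 1.
  rewrite /w -cisMn -(mulr_natr (- _) n) mulNr divfK ?gt_eqF//.
  have : cis (2 * pi * m%:R : R) * cis (- (2 * pi * m%:R : R)) = 1.
    by rewrite -cisD subrr cis0.
  by rewrite (mulr_natr (2 * pi) m) cisMn cis2pi expr1n mul1r.
have := subrX1 w n; rewrite wn subrr => /esym/eqP.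
by rewrite mulf_eq0 subr_eq0 (negbTE w1)/= => /eqP.
Qed.

(** All nonconstant frequencies are below the number n of nodes, so the sums over n-th roots of
    unity annihilate them and the quadrature is exact. This is why the order of truncation equals
    the number of nodes. *)
Lemma sum_herglotz_trunc n q :
  \sum_(i < n) herglotz_trunc n (q * cis (- (2 * pi * i%:R / n%:R))) = n%:R.
Proof.
rewrite big_split/= sumr_const card_ord -mulr_sumr exchange_big/=.
rewrite big_nat big1 ?mulr0 ?addr0// => m mn.
under eq_bigr do rewrite exprMn.
by rewrite -mulr_sumr sum_rootX ?mulr0.
Qed.

End Herglotz.

(** * Sums over consecutive blocks *)

Section BlockSums.
Variable R : realType.

Lemma sum_blocks (V : nmodType) (F : nat -> V) m p :
  \sum_(i < m * p) F i = \sum_(k < m) \sum_(j < p) F (k * p + j)%N.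
Proof.
elim: m => [|m IH]; first by rewrite mul0n !big_ord0.
rewrite big_ord_recr/= -IH -!(big_mkord xpredT) mulSnr.
rewrite (@big_cat_nat _ _ _ (m * p) 0 (m * p + p))//= ?leq_addr//; congr (_ + _).
by rewrite -{1}(add0n (m * p)%N) big_addn addKn big_mkord; apply: eq_bigr => j _; rewrite addnC.
Qed.

(** A kernel varying by a factor at most [Q] on each block sees little more than the block means of
    [u]. *)
Lemma sum_blocks_le m p (u X : nat -> R) (B Q : R) : (0 < p)%N -> 0 <= Q ->
  (forall i, 0 <= u i) ->
  (forall i, (i < m * p)%N -> 0 <= X i) ->
  (forall k, (k < m)%N -> \sum_(j < p) u (k * p + j)%N <= p%:R * B) ->
  (forall k i j, (k < m)%N -> (i < p)%N -> (j < p)%N ->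
    X (k * p + i)%N <= Q * X (k * p + j)%N) ->
  \sum_(i < m * p) u i * X i <= B * Q * \sum_(i < m * p) X i.
Proof.
move=> p0 Q0 u0 X0 uB XQ.
have pR : (0 : R) < p%:R by rewrite ltr0n.
rewrite (sum_blocks (fun i => u i * X i)) (sum_blocks X) mulr_sumr.
apply: ler_sum => k _.
have sX0 : 0 <= \sum_(j < p) X (k * p + j)%N.
  apply: sumr_ge0 => j _; apply: X0.
  by rewrite (@leq_trans (k.+1 * p))// ?leq_mul2r ?ltn_ord ?orbT// mulSnr ltn_add2l.
rewrite -(ler_pM2l pR).
have step : p%:R * \sum_(j < p) u (k * p + j)%N * X (k * p + j)%N <=
    Q * ((\sum_(j < p) u (k * p + j)%N) * \sum_(j < p) X (k * p + j)%N).
  have -> : p%:R * \sum_(j < p) u (k * p + j)%N * X (k * p + j)%N =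
      \sum_(j < p) \sum_(i < p) u (k * p + j)%N * X (k * p + j)%N.
    by rewrite mulr_sumr; apply: eq_bigr => j _; rewrite sumr_const card_ord mulr_natl.
  rewrite mulr_suml mulr_sumr; apply: ler_sum => j _.
  rewrite !mulr_sumr; apply: ler_sum => i _.
  by rewrite mulrCA ler_wpM2l// XQ.
apply: (le_trans step); rewrite mulrA.
have -> : p%:R * (B * Q * \sum_(j < p) X (k * p + j)%N)
  = Q * (p%:R * B) * \sum_(j < p) X (k * p + j)%N by ring.
by rewrite ler_wpM2r// ler_wpM2l// uB.
Qed.

End BlockSums.

(** * The discretised Herglotz integral as a polynomial *)

Section ExponentPolynomial.
Variable R : realType.
Variables (n : nat) (r : R) (u : nat -> R).
Hypotheses (n_gt0 : (0 < n)%N) (r_gt0 : 0 < r) (r_lt1 : r < 1).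
Implicit Types (z q a : R[i]) (c d M B : R).

Definition node (n i : nat) : R := 2 * pi * i%:R / n%:R.

(** The argument of the kernel: z is dilated by [r] and rotated so that node [i] comes to 1. *)
Definition pull z i : R[i] := r%:C * z * cis (- node n i).

Definition kernel_poly a : {poly R[i]} :=
  1 + 2 *: \sum_(1 <= m < n) a ^+ m *: 'X^m.

(** Riemann sum of the Herglotz integral of [u], with truncated kernels so that it is a polynomial
    in z, minus the constant [c]. *)
Definition exponent c : {poly R[i]} :=
  \sum_(i < n) (u i / n%:R)%:C *: kernel_poly (r%:C * cis (- node n i))
    - c%:C%:P.

Definition poisson_mean z : R := (\sum_(i < n) u i * poisson (pull z i)) / n%:R.

Lemma normc_pull z i : normc (pull z i) = r * normc z.
Proof. by rewrite !Normc.normcM normc_cis mulr1 normcR gtr0_norm. Qed.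

Lemma normc_pull_le z i : normc z <= 1 -> normc (pull z i) <= r.
Proof. by move=> z1; rewrite normc_pull ger_pMr. Qed.

Lemma horner_exponent c z : (exponent c).[z] =
  \sum_(i < n) (u i / n%:R)%:C * herglotz_trunc n (pull z i) - c%:C.
Proof.
rewrite /exponent hornerD hornerN hornerC horner_sum; congr (_ - _).
apply: eq_bigr => i _; rewrite hornerZ; congr (_ * _).
rewrite /kernel_poly hornerD hornerZ hornerC horner_sum /herglotz_trunc.
congr (_ + _ * _); apply: eq_bigr => m _.
by rewrite hornerZ hornerXn -exprMn /pull mulrAC.
Qed.

Lemma trunc_error_ge0 : 0 <= trunc_error n r.
Proof. by rewrite divr_ge0 ?mulr_ge0 ?exprn_ge0 ?subr_ge0 ?(ltW r_gt0) ?(ltW r_lt1). Qed.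

Let nR : 0 < n%:R :> R. Proof. by rewrite ltr0n. Qed.

Let pull_lt1 z i : normc z <= 1 -> normc (pull z i) < 1.
Proof. by move=> z1; rewrite (le_lt_trans (normc_pull_le i z1)). Qed.

(** The truncated kernels have mean exactly 1 over the nodes, so only the truncation error is
    left. *)
Lemma mean_poisson_error z : normc z <= 1 ->
  `|(\sum_(i < n) poisson (pull z i)) / n%:R - 1| <= trunc_error n r.
Proof.
move=> z1; have -> (S : R) : S / n%:R - 1 = (S - n%:R) / n%:R.
  by field; rewrite gt_eqF.
rewrite normrM.
rewrite [ `|n%:R^-1|]ger0_norm ?invr_ge0 ?ler0n// ler_pdivrMr//.
have -> : \sum_(i < n) poisson (pull z i) - n%:R =
    \sum_(i < n) complex.Re (herglotz (pull z i) - herglotz_trunc n (pull z i)).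
  have -> : (n%:R : R) = complex.Re (n%:R : R[i]).
    by rewrite -(rmorph_nat (real_complex R)).
  rewrite -(sum_herglotz_trunc n (r%:C * z)) Re_sum -sumrB.
  apply: eq_bigr => i _; rewrite -Re_herglotz; last exact: pull_lt1.
  by rewrite ReD; congr (_ + _); rewrite /pull; case: (herglotz_trunc _ _).
apply: (le_trans (ler_norm_sum _ _ _)).
have -> : trunc_error n r * n%:R = \sum_(i < n) trunc_error n r.
  by rewrite sumr_const card_ord mulr_natr.
apply: ler_sum => i _.
rewrite (le_trans (Re_le_normc _))// normcB_sym herglotz_trunc_error//.
exact: normc_pull_le.
Qed.

Hypothesis u_ge0 : forall i, 0 <= u i.
Variable M : R.
Hypothesis u_mean : \sum_(i < n) u i = n%:R * M.

Let M_ge0 : 0 <= M.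
Proof. by rewrite -(pmulr_rge0 _ nR) -u_mean sumr_ge0. Qed.

Lemma Re_exponent_le c z : normc z <= 1 ->
  complex.Re (exponent c).[z] <= poisson_mean z + M * trunc_error n r - c.
Proof.
move=> z1; rewrite horner_exponent ReD lerD// Re_sum /poisson_mean.
have -> : M = (\sum_(i < n) u i) / n%:R by rewrite u_mean mulrAC divff ?gt_eqF ?mul1r.
rewrite !mulr_suml -big_split/=; apply: ler_sum => i _.
have -> : u i * poisson (pull z i) / n%:R + u i / n%:R * trunc_error n r =
    u i / n%:R * (poisson (pull z i) + trunc_error n r) by ring.
rewrite Re_scale ler_wpM2l ?divr_ge0 ?ler0n//.
rewrite -lerBlDl -(Re_herglotz (pull_lt1 i z1)).
have -> : complex.Re (herglotz_trunc n (pull z i)) - complex.Re (herglotz (pull z i))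
  = complex.Re (herglotz_trunc n (pull z i) - herglotz (pull z i)).
  by rewrite ReD; congr (_ + _); case: (herglotz _).
rewrite (le_trans (ler_norm _))// (le_trans (Re_le_normc _))//.
by rewrite herglotz_trunc_error// normc_pull_le.
Qed.

Lemma normc_pullB z i j :
  normc z <= 1 -> normc (pull z i - pull z j) <= 2 * `|node n i - node n j|.
Proof.
move=> z1; rewrite /pull -mulrBr !Normc.normcM normcR gtr0_norm//.
apply: (@le_trans _ _ (normc (cis (- node n i) - cis (- node n j)))).
  by rewrite ler_piMl ?normc_ge0// mulr_ile1 ?normc_ge0 ?(ltW r_gt0) ?(ltW r_lt1).
by rewrite (le_trans (normc_cisB_le _ _))// -opprD normrN.
Qed.

Section Blocks.
Variables (m p : nat).
Hypotheses (m_gt0 : (0 < m)%N) (p_gt0 : (0 < p)%N) (nmp : n = (m * p)%N).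

Lemma node_block k i j : (i < p)%N -> (j < p)%N ->
  `|node n (k * p + i) - node n (k * p + j)| <= 2 * pi / m%:R.
Proof.
move=> ip jp; have p0 : (0 : R) < pi := pi_gt0 R.
have pR : (0 : R) < p%:R by rewrite ltr0n.
have mR : (0 : R) < m%:R by rewrite ltr0n.
have -> : node n (k * p + i) - node n (k * p + j) =
    2 * pi / m%:R * ((i%:R - j%:R) / p%:R).
  by rewrite /node nmp natrM !natrD; field; rewrite !gt_eqF.
have c0 : 0 <= 2 * pi / m%:R :> R by rewrite divr_ge0 ?mulr_ge0 ?ler0n ?pi_ge0.
rewrite normrM (ger0_norm c0) ler_piMr// normrM.
rewrite [ `|p%:R^-1|]ger0_norm ?invr_ge0 ?ler0n// ler_pdivrMr// mul1r.
have := ltr_nat R i p; have := ltr_nat R j p; rewrite ip jp => hj hi.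
have i0 := ler0n R i; have j0 := ler0n R j.
by rewrite ler_norml; apply/andP; split; lra.
Qed.

(** Harnack's inequality on blocks of angular length 2 pi / m: the square is the factor by which the
    kernel can vary on a block, and the last factor bounds the mean of the kernels. *)
Lemma poisson_mean_le B z : normc z <= 1 ->
  (forall k, (k < m)%N -> \sum_(j < p) u (k * p + j)%N <= p%:R * B) ->
  0 <= B ->
  poisson_mean z <=
    B * (1 + 2 * (2 * pi / m%:R) / (1 - r * normc z)) ^+ 2
      * (1 + trunc_error n r).
Proof.
move=> z1 uB B0; rewrite /poisson_mean ler_pdivrMr// -mulrA.
have rz1 : r * normc z < 1.
  by rewrite (le_lt_trans _ r_lt1)// ger_pMr.
set Q := (1 + _ / _) ^+ 2.
have Q0 : 0 <= Q by rewrite sqr_ge0.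
apply: (@le_trans _ _ (B * Q * \sum_(i < n) poisson (pull z i))).
  have X0 i : 0 <= poisson (pull z i).
    by rewrite poisson_ge0// ltW// pull_lt1.
  have nF (F : nat -> R) : \sum_(i < n) F i = \sum_(i < m * p) F i by rewrite nmp.
  rewrite (nF (fun i => u i * poisson (pull z i))) (nF (fun i => poisson (pull z i))).
  apply: (sum_blocks_le (X := fun i => poisson (pull z i))) => // k i j km ip jp.
  have e (s t : nat) : normc (pull z t) = normc (pull z s) by rewrite !normc_pull.
  apply: (le_trans (poisson_le (e (k * p + i)%N (k * p + j)%N) (pull_lt1 _ z1))).
  rewrite ler_wpM2r// normc_pull lerXn2r ?nnegrE//.
  - by rewrite addr_ge0 ?divr_ge0 ?normc_ge0 ?subr_ge0 ?(ltW rz1).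
  - rewrite addr_ge0// divr_ge0 ?subr_ge0 ?(ltW rz1)//.
    by rewrite !mulr_ge0 ?invr_ge0 ?ler0n ?pi_ge0.
  - rewrite lerD2l ler_wpM2r ?invr_ge0 ?subr_ge0 ?(ltW rz1)//.
    by rewrite (le_trans (normc_pullB _ _ z1))// ler_wpM2l// node_block.
have -> : B * (Q * (1 + trunc_error n r)) * n%:R =
    B * Q * ((1 + trunc_error n r) * n%:R) by ring.
apply: ler_wpM2l; first exact: mulr_ge0.
rewrite -(ler_pdivrMr _ _ nR).
by have := mean_poisson_error z1; rewrite ler_norml => /andP[_]; rewrite lerBlDl.
Qed.

(** Since [u] has mean [M] on every block, the kernel may be replaced by its increment from the
    first node of the block; this increment is small because blocks are short compared with the
    distance to the circle. *)
Lemma exponent_small c z : normc z < 1 ->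
  (forall k, (k < m)%N -> \sum_(j < p) u (k * p + j)%N = p%:R * M) ->
  normc ((exponent c).[z] - (M - c)%:C) <=
    M * (8 * (2 * pi / m%:R) / (1 - normc z) ^+ 2 + 4 * trunc_error n r).
Proof.
move=> z1 uB; set b := _ + 4 * _.
pose T i := herglotz_trunc n (pull z i).
have TB k i : (k < m)%N -> (i < p)%N ->
    normc (T (k * p + i)%N - T (k * p)%N) <= b / 2.
  move=> km ip.
  have -> : T (k * p + i)%N - T (k * p)%N =
      (T (k * p + i)%N - herglotz (pull z (k * p + i)%N))
      + (herglotz (pull z (k * p + i)%N) - herglotz (pull z (k * p)%N))
      - (T (k * p)%N - herglotz (pull z (k * p)%N)) by ring.
  have qz (s : nat) : normc (pull z s) <= normc z.
    by rewrite normc_pull ler_piMl ?normc_ge0// ltW.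
  have h1 := herglotz_trunc_error n_gt0 (normc_pull_le (k * p + i)%N (ltW z1)) r_lt1.
  have h2 := herglotz_trunc_error n_gt0 (normc_pull_le (k * p)%N (ltW z1)) r_lt1.
  have h3 := herglotzB_le (qz (k * p + i)%N) (qz (k * p)%N) z1.
  have h4 : normc (pull z (k * p + i)%N - pull z (k * p)%N) <= 2 * (2 * pi / m%:R).
    rewrite (le_trans (normc_pullB _ _ (ltW z1)))// ler_wpM2l//.
    by rewrite -{2}(addn0 (k * p)%N) node_block.
  have h5 : 2 * normc (pull z (k * p + i)%N - pull z (k * p)%N) / (1 - normc z) ^+ 2
      <= 4 * (2 * pi / m%:R) / (1 - normc z) ^+ 2.
    rewrite ler_wpM2r ?invr_ge0 ?sqr_ge0//.
    have -> : 4 * (2 * pi / m%:R) = 2 * (2 * (2 * pi / m%:R)) :> R by ring.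
    by rewrite ler_wpM2l.
  rewrite (le_trans (le_normcD _ _))// normcN.
  apply: (le_trans (lerD (le_normcD _ _) (lexx _))).
  apply: (le_trans (lerD (lerD h1 (le_trans h3 h5)) h2)).
  by rewrite /b; lra.
have b0 : 0 <= b.
  apply: addr_ge0; last exact: mulr_ge0 (ler0n _ 4) trunc_error_ge0.
  by rewrite divr_ge0 ?sqr_ge0// !mulr_ge0 ?invr_ge0 ?ler0n ?pi_ge0.
have E : (exponent c).[z] - (M - c)%:C =
    \sum_(i < m * p) ((u i - M) / n%:R)%:C * T i.
  have <- : \sum_(i < n) ((u i - M) / n%:R)%:C * T i
      = \sum_(i < m * p) ((u i - M) / n%:R)%:C * T i by rewrite nmp.
  rewrite horner_exponent.
  rewrite [RHS](eq_bigr (fun i : 'I_n => (u i / n%:R)%:C * T i - (M / n%:R)%:C * T i)); last first.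
    by move=> i _; rewrite mulrBl rmorphB/= mulrBl.
  rewrite sumrB -mulr_sumr /T /pull sum_herglotz_trunc.
  have -> : (M / n%:R)%:C * n%:R = M%:C :> R[i].
    by rewrite -(rmorph_nat (real_complex R)) -rmorphM/= divfK ?gt_eqF.
  by rewrite rmorphB/=; ring.
have E2 : (exponent c).[z] - (M - c)%:C = \sum_(k < m) \sum_(j < p)
   ((u (k * p + j)%N - M) / n%:R)%:C * (T (k * p + j)%N - T (k * p)%N).
  rewrite E (sum_blocks (fun i => ((u i - M) / n%:R)%:C * T i)).
  apply: eq_bigr => k _; apply/esym.
  under eq_bigr do rewrite mulrBr.
  rewrite sumrB -mulr_suml -rmorph_sum/= -mulr_suml sumrB uB// sumr_const card_ord.
  by rewrite (mulr_natl M p) subrr mul0r rmorph0 mul0r subr0.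
rewrite E2 (le_trans (normc_sum_le _))//.
apply: (@le_trans _ _ (\sum_(k < m) \sum_(j < p) (u (k * p + j)%N + M) / n%:R * (b / 2))).
  apply: ler_sum => k _; rewrite (le_trans (normc_sum_le _))//.
  apply: ler_sum => j _; rewrite Normc.normcM ler_pM ?normc_ge0//; last exact: TB.
  rewrite normcR normrM [ `|n%:R^-1|]ger0_norm ?invr_ge0 ?ler0n//.
  rewrite ler_wpM2r ?invr_ge0 ?ler0n// (le_trans (ler_normB _ _))//.
  by rewrite !ger0_norm.
rewrite -(sum_blocks (fun i => (u i + M) / n%:R * (b / 2))) -nmp.
rewrite -!mulr_suml big_split/= u_mean sumr_const card_ord -mulr_natl.
by rewrite le_eqVlt; apply/orP; left; apply/eqP; field; rewrite gt_eqF.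
Qed.

End Blocks.

End ExponentPolynomial.

(** * Boundary values of Poisson means of step functions *)

Section BoundaryValues.
Variable R : realType.
Implicit Types (r t d x : R).

Lemma cos_far d x : 0 <= d <= pi -> d <= `|x| <= 2 * pi - d -> cos x <= cos d.
Proof.
move=> /andP[d0 dpi] /andP[dx xd]; rewrite -(cos_norm x).
set y := `|x| in dx xd *.
have p0 := @pi_gt0 R.
have mono (a b : R) : 0 <= a -> a <= b -> b <= pi -> cos b <= cos a.
  move=> a0 ab bp; rewrite leNgt ltr_cos ?in_itv/= -?leNgt//.
  - by rewrite bp (le_trans a0).
  - by rewrite a0 (le_trans ab).
have [yp|yp] := leP y pi; first exact: mono.
have -> : cos y = cos (2 * pi - y).
  by rewrite cosB mulr_natl cos2pi sin2pi mul1r mul0r addr0.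
by apply: mono => //; lra.
Qed.

(** The squared denominator is (1 - r)^2 + 2 r (1 - cos x), which is at least 1 - cos d because 2 r
    >= 1; the numerator is at most 2 (1 - r). *)
Lemma poisson_far_le r d x : 2^-1 <= r -> r < 1 -> 0 < d <= pi ->
  d <= `|x| <= 2 * pi - d ->
  poisson (r%:C * cis x) <= 2 * (1 - r) / (1 - cos d).
Proof.
move=> r2 r1 /andP[d0 dp] dx.
have cd : cos d < 1.
  have := @ltr_cos R 0 d; rewrite !in_itv/= lexx pi_ge0 (ltW d0) dp/=.
  by move=> /(_ isT isT); rewrite cos0 d0.
have cx : cos x <= cos d by apply: cos_far => //; rewrite ltW.
have r0 : 0 < r by lra.
rewrite /poisson Normc.normcM normcR normc_cis mulr1 gtr0_norm//.
have -> : normc (1 - r%:C * cis x) ^+ 2 = (1 - r) ^+ 2 + 2 * r * (1 - cos x).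
  rewrite normc_sqr /=.
  have -> : (1 - (r * cos x - 0 * sin x)) ^+ 2 + (0 - (r * sin x + 0 * cos x)) ^+ 2
     = 1 - 2 * r * cos x + r ^+ 2 * (cos x ^+ 2 + sin x ^+ 2) by ring.
  by rewrite cos2Dsin2; ring.
have h : 1 - cos d <= (1 - r) ^+ 2 + 2 * r * (1 - cos x) by nra.
have cd' : 0 < 1 - cos d by rewrite subr_gt0.
rewrite ler_pM ?subr_ge0 ?exprn_ile1 ?(ltW r0) ?(ltW r1) ?invr_ge0//.
- by rewrite addr_ge0 ?sqr_ge0// mulr_ge0 ?subr_ge0 ?cos_le1// mulr_ge0// ltW.
- by nra.
- by rewrite lef_pV2 ?posrE// (lt_le_trans cd').
Qed.

(** For a point of cell [k] at distance [d] from its endpoints, the nodes of the same cell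
    contribute at most [f k] times the total kernel, and all other nodes lie where the kernel is of
    order 1 - r. *)
Lemma poisson_mean_boundary (m p : nat) r (f : nat -> R) d x (k : nat) (A : R) :
  (0 < m)%N -> (0 < p)%N -> 2^-1 <= r -> r < 1 -> 0 < d <= pi ->
  (forall i, 0 <= f i <= A) -> (k < m)%N ->
  2 * pi * k%:R / m%:R + d <= x <= 2 * pi * k.+1%:R / m%:R - d ->
  poisson_mean (m * p) r (fun i => f (i %/ p)%N) (cis x) <=
    f k * (1 + trunc_error (m * p) r) + A * (2 * (1 - r) / (1 - cos d)).
Proof.
move=> m0 p0 r2 r1 dd fA km /andP[x1 x2].
have r0 : 0 < r by rewrite (lt_le_trans _ r2)// invr_gt0.
have n0 : (0 < m * p)%N by rewrite muln_gt0 m0.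
have nR : (0 : R) < (m * p)%:R by rewrite ltr0n.
have c1 : normc (cis x) <= 1 by rewrite normc_cis.
have mean := mean_poisson_error n0 r0 r1 c1.
rewrite /poisson_mean ler_pdivrMr//.
set B := 2 * (1 - r) / (1 - cos d).
have fk0 := fA k.
have B0 : 0 <= B.
  rewrite divr_ge0// ?subr_ge0 ?cos_le1// mulr_ge0// subr_ge0 ltW//.
have mR : (0 : R) < m%:R by rewrite ltr0n.
have pp := @pi_gt0 R.
apply: (@le_trans _ _ (\sum_(i < m * p)
    (f k * poisson (pull (m * p) r (cis x) i) + A * B))).
  apply: ler_sum => i _.
  have P0 : 0 <= poisson (pull (m * p) r (cis x) i).
    by rewrite poisson_ge0// normc_pull// normc_cis mulr1 ltW.
  have [<-|ik] := eqVneq (i %/ p)%N k.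
    by rewrite lerDl mulr_ge0//; have /andP[a0 a1] := fA k; exact: le_trans a1.
  apply: (@le_trans _ _ (A * B)); last first.
    by rewrite lerDr mulr_ge0//; have /andP[] := fk0.
  have /andP[fi0 fiA] := fA (i %/ p)%N.
  rewrite ler_pM// /pull -mulrA -cisD /B; apply: poisson_far_le => //.
  have pR : (0 : R) < p%:R by rewrite ltr0n.
  have nodeE (a : nat) : 2 * pi * (a * p)%:R / (m * p)%:R = 2 * pi * a%:R / m%:R :> R.
    by rewrite !natrM; field; rewrite !gt_eqF.
  have node_le (a b : nat) : (a <= b)%N ->
      2 * pi * a%:R / (m * p)%:R <= 2 * pi * b%:R / (m * p)%:R :> R.
    move=> ab; rewrite ler_wpM2r ?invr_ge0 ?ler0n// ler_wpM2l ?ler_nat//.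
    by rewrite mulr_ge0// ltW.
  have km' : 2 * pi * k.+1%:R / m%:R <= 2 * pi :> R.
    by rewrite ler_pdivrMr// ler_wpM2l ?ler_nat// mulr_ge0// ltW.
  have k0 : 0 <= 2 * pi * k%:R / m%:R :> R.
    by rewrite divr_ge0 ?ler0n// mulr_ge0// mulr_ge0// ltW.
  have i0 := node_le 0%N i (leq0n _); rewrite mulr0 mul0r in i0.
  have iN := node_le i (m * p)%N (ltnW (ltn_ord i)).
  rewrite mulfK ?gt_eqF// in iN.
  rewrite /node; have [lt|gt] : (i < k * p)%N \/ (k.+1 * p <= i)%N.
    move: ik; rewrite neq_ltn => /orP[lt|gt]; first by left; rewrite -ltn_divLR.
    by right; rewrite -leq_divRL.
  - have := node_le i (k * p)%N (ltnW lt); rewrite nodeE => h.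
    by rewrite ger0_norm; [apply/andP; split|]; lra.
  - have := node_le (k.+1 * p)%N i gt; rewrite nodeE => h.
    by rewrite ler0_norm; [apply/andP; split|]; lra.
rewrite big_split/= sumr_const card_ord -(mulr_natr (A * B)) -mulr_sumr.
rewrite [leRHS]mulrDl lerD2r.
rewrite -mulrA ler_wpM2l//; first by case/andP: fk0.
rewrite -(ler_pdivrMr _ _ nR).
by move: mean; rewrite ler_norml => /andP[_]; rewrite lerBlDl.
Qed.

End BoundaryValues.

(** * Replacing the exponential by a polynomial power *)

Section PowerPolynomial.
Variable R : realType.
Implicit Types (z q : R[i]) (g : {poly R[i]}).

Lemma normc_horner_bound g :
  exists2 G : R, 0 <= G & forall z, normc z <= 1 -> normc g.[z] <= G.
Proof.
exists (\sum_(i < size g) normc g`_i); first by apply: sumr_ge0 => i _; exact: normc_ge0.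
move=> z z1; rewrite horner_coef (le_trans (normc_sum_le _))//.
apply: ler_sum => i _; rewrite Normc.normcM normcX ler_piMr ?normc_ge0//.
by rewrite exprn_ile1 ?normc_ge0.
Qed.

(** |1 + q/K|^2 = 1 + 2 Re q / K + |q|^2 / K^2, to which 1 + y <= exp y applies. The bound involves
    Re q and not |q|, up to a term that vanishes for large K. *)
Lemma normc_1DX_le q K : (0 < K)%N ->
  normc ((1 + (K%:R^-1)%:C * q) ^+ K) <=
    expR (complex.Re q + normc q ^+ 2 / (2 * K%:R)).
Proof.
move=> K0; have KR : (0 : R) < K%:R by rewrite ltr0n.
have -> : complex.Re q + normc q ^+ 2 / (2 * K%:R) =
    K%:R * ((2 * complex.Re q / K%:R + normc q ^+ 2 / K%:R ^+ 2) / 2).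
  by field; rewrite gt_eqF.
rewrite normcX expRM_natl lerXn2r ?nnegrE ?normc_ge0 ?expR_ge0//.
rewrite -(ler_pXn2r (ltn0Sn 1)) ?nnegrE ?normc_ge0 ?expR_ge0//.
rewrite -expRM_natl.
set y := 2 * complex.Re q / K%:R + normc q ^+ 2 / K%:R ^+ 2.
have -> : 2 * (y / 2) = y by field.
apply: le_trans (expR_ge1Dx y).
rewrite !normc_sqr /y !normc_sqr; case: q {y} => a b /=.
by rewrite le_eqVlt; apply/orP; left; apply/eqP; field; rewrite gt_eqF.
Qed.

(** Expanding the power gives |(1 + s)^j - 1| <= (1 + |s|)^j - 1, and the resulting bound is uniform
    in K. *)
Lemma normc_1DXB1_le q K : (0 < K)%N ->
  normc ((1 + (K%:R^-1)%:C * q) ^+ K - 1) <= expR (normc q) - 1.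
Proof.
move=> K0; have KR : (0 : R) < K%:R by rewrite ltr0n.
have E (s : R[i]) j : normc ((1 + s) ^+ j - 1) <= (1 + normc s) ^+ j - 1.
  elim: j => [|j IH]; first by rewrite !expr0 !subrr Normc.normc0.
  have -> : (1 + s) ^+ j.+1 - 1 = (1 + s) * ((1 + s) ^+ j - 1) + s.
    by rewrite exprS; ring.
  have -> : (1 + normc s) ^+ j.+1 - 1 =
      (1 + normc s) * ((1 + normc s) ^+ j - 1) + normc s.
    by rewrite exprS; ring.
  rewrite (le_trans (le_normcD _ _))// lerD2r Normc.normcM ler_pM ?normc_ge0//.
  by rewrite (le_trans (le_normcD _ _))// Normc.normc1.
rewrite (le_trans (E _ _))// lerD2r.
have -> : normc q = K%:R * (normc q / K%:R) by field; rewrite gt_eqF.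
rewrite expRM_natl lerXn2r ?nnegrE ?expR_ge0 ?addr_ge0 ?normc_ge0//.
rewrite Normc.normcM normcR ger0_norm ?invr_ge0 ?ler0n//.
by rewrite mulrC expR_ge1Dx.
Qed.

Definition power_poly g K : {poly R[i]} := (1 + (K%:R^-1)%:C *: g) ^+ K.

Lemma horner_power_poly g K z :
  (power_poly g K).[z] = (1 + (K%:R^-1)%:C * g.[z]) ^+ K.
Proof. by rewrite horner_exp hornerD hornerZ hornerC. Qed.

Lemma power_poly_bounds g (e : R) : 0 < e -> exists p : {poly R[i]},
  (forall z, normc z <= 1 -> normc p.[z] <= expR (complex.Re g.[z] + e)) /\
  (forall z, normc (p.[z] - 1) <= expR (normc g.[z]) - 1).
Proof.
move=> e0; have [G G0 gG] := normc_horner_bound g.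
(* Large enough for G^2 / K <= e, which absorbs the quadratic error on the closed disk. *)
pose K := (Num.truncn (G ^+ 2 / e)).+1.
have KR : (0 : R) < K%:R by rewrite ltr0n.
exists (power_poly g K); split=> z; rewrite horner_power_poly; last exact: normc_1DXB1_le.
move=> z1; rewrite (le_trans (normc_1DX_le _ _))// ler_expR lerD2l.
rewrite ler_pdivrMr ?mulr_gt0//.
have GK : G ^+ 2 <= e * K%:R.
  by rewrite mulrC -ler_pdivrMr// ltW// /K truncnS_gt.
have : normc g.[z] ^+ 2 <= G ^+ 2 by rewrite lerXn2r ?nnegrE ?normc_ge0// gG.
have : 0 < e * K%:R by rewrite mulr_gt0.
by nra.
Qed.

End PowerPolynomial.

(** * The gauge at dyadic scales *)

Section Gauge.
Variables (R : realType) (h : R -> R).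
Hypothesis hh : gauge_function h.

Definition arc_length (l : nat) : R := 2 * pi / (2 ^ l)%:R.

(** The cap on means over arcs of level [l]. Multiplied by the arc length it is
    [e * h (arc_length l)], which is how Carleson sums become sums of masses. *)
Definition gauge_bound (e : R) l : R := e * (h (arc_length l) / arc_length l).

Lemma pow2_gt0 l : (0 : R) < (2 ^ l)%:R.
Proof. by rewrite ltr0n expn_gt0. Qed.

Lemma arc_length_gt0 l : 0 < arc_length l.
Proof. by rewrite divr_gt0 ?pow2_gt0// mulr_gt0// pi_gt0. Qed.

Lemma arc_lengthS l : arc_length l = 2 * arc_length l.+1.
Proof.
by rewrite /arc_length expnS natrM; field; rewrite gt_eqF ?pow2_gt0.
Qed.

Lemma arc_length_le l l' : (l <= l')%N -> arc_length l' <= arc_length l.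
Proof.
move=> ll'; rewrite ler_wpM2l ?mulr_ge0 ?pi_ge0//.
by rewrite lef_pV2 ?posrE ?pow2_gt0// ler_nat leq_exp2l.
Qed.

Lemma arc_length_cvg : arc_length l @[l --> \oo] --> 0.
Proof.
have -> : arc_length = (fun l => 2 * pi * (2^-1) ^+ l).
  by apply: funext => l; rewrite /arc_length natrX exprVn.
rewrite -[X in _ --> X](mulr0 (2 * pi)); apply: cvgM; first exact: cvg_cst.
by apply: cvg_expr; rewrite ger0_norm ?invr_ge0// invf_lt1 ?ltr1n.
Qed.

Lemma gauge_ge0 x : 0 <= x -> 0 <= h x.
Proof. by case: hh => _ mono h0 _ _ x0; rewrite -h0 mono. Qed.

Lemma gauge_bound_ge0 e l : 0 <= e -> 0 <= gauge_bound e l.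
Proof.
move=> e0; rewrite mulr_ge0// divr_ge0 ?(ltW (arc_length_gt0 l))//.
by rewrite gauge_ge0// (ltW (arc_length_gt0 l)).
Qed.

Lemma gauge_bound_nd e l l' : 0 <= e -> (l <= l')%N ->
  gauge_bound e l <= gauge_bound e l'.
Proof.
case: hh => _ _ _ dec _ e0 ll'; rewrite ler_wpM2l// dec ?arc_length_gt0//.
exact: arc_length_le.
Qed.

Lemma gauge_bound_cvg e : 0 < e -> gauge_bound e l @[l --> \oo] --> +oo.
Proof.
move=> e0; case: hh => _ _ _ _ hy.
apply/cvgryPge => A; move/cvgryPge : hy => /(_ (A / e)) hA.
have := arc_length_cvg.
have at0 : arc_length l @[l --> \oo] --> 0^'+.
  move=> U /= [eps eps0 HU]; have := arc_length_cvg.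
  move=> /cvgrPdist_lt /(_ _ eps0) [N _ HN]; exists N => // l Nl /=.
  by apply: HU; [exact: HN | exact: arc_length_gt0].
move=> _; have [N _ HN] := at0 _ hA; exists N => // l Nl /=.
by rewrite /gauge_bound -ler_pdivrMl// mulrC; exact: HN.
Qed.

Lemma gauge_arc_cvg : h (arc_length l) @[l --> \oo] --> 0.
Proof.
case: hh => ch _ h0 _ _.
have /subspace_continuousP := ch.
move=> /(_ 0); rewrite /= in_itv/= lexx => /(_ isT) hc.
rewrite -h0; apply/cvgrPdist_lt => e e0.
move/cvgrPdist_lt : hc => /(_ _ e0) [d /= d0 Hd].
have /cvgrPdist_lt /(_ _ d0) [N _ HN] := arc_length_cvg.
exists N => // l Nl /=; apply: Hd; first exact: HN.
by rewrite /= in_itv/= andbT ltW// arc_length_gt0.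
Qed.

End Gauge.

(** * From a step function with controlled dyadic means to a polynomial *)

Section FlowPolynomial.
Variables (R : realType) (h : R -> R) (e M A : R) (n0 D : nat) (f : nat -> R).
Hypothesis hh : gauge_function h.
Hypothesis e_gt0 : 0 < e.
Hypothesis M_ge0 : 0 <= M.
Hypothesis f_bnd : forall i, 0 <= f i <= A.
Hypothesis f_sum : forall k, (k < 2 ^ n0)%N ->
  \sum_(j < 2 ^ D) f (k * 2 ^ D + j)%N = (2 ^ D)%:R * M.
Hypothesis f_le : forall i k, (i <= D)%N -> (k < 2 ^ (n0 + i))%N ->
  \sum_(j < 2 ^ (D - i)) f (k * 2 ^ (D - i) + j)%N
    <= (2 ^ (D - i))%:R * gauge_bound h e (n0 + i).

Let N := (n0 + D)%N.
Let b := gauge_bound h e.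
Let A_ge0 : 0 <= A. Proof. by have /andP[a0 a1] := f_bnd 0; exact: le_trans a1. Qed.

Let f_leaf k : (k < 2 ^ N)%N -> f k <= b N.
Proof.
move=> kN; have := f_le (leqnn D) kN.
by rewrite subnn expn0 big_ord1 muln1 addn0 mul1r.
Qed.

Let M_le : M <= b n0.
Proof.
have := @f_le 0 0 (leq0n _); rewrite subn0 addn0 expn_gt0 => /(_ isT).
by rewrite f_sum ?expn_gt0// ler_pM2l// pow2_gt0.
Qed.

Section Grid.
Variable P : nat.
(** Each cell value is repeated at [2 ^ P] nodes, so the number of nodes can grow while [f] stays
    fixed. *)
Let u i := f (i %/ 2 ^ P)%N.

Lemma grid_block_sum q k :
  \sum_(j < q * 2 ^ P) u (k * (q * 2 ^ P) + j)%N =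
  (2 ^ P)%:R * \sum_(j < q) f (k * q + j)%N.
Proof.
rewrite (sum_blocks (fun j => u (k * (q * 2 ^ P) + j)%N)) mulr_sumr.
apply: eq_bigr => j _; rewrite (eq_bigr (fun=> f (k * q + j)%N)).
  by rewrite sumr_const card_ord mulr_natl.
move=> i _; rewrite /u mulnA addnA -mulnDl divnMDl ?expn_gt0//.
by rewrite divn_small// addn0.
Qed.

(** Up to level [N] these are the assumed bounds on means; beyond it a block lies inside one cell,
    whose value is at most [b N <= b l]. *)
Lemma grid_block_le l k : (n0 <= l <= N + P)%N -> (k < 2 ^ l)%N ->
  \sum_(j < 2 ^ (N + P - l)) u (k * 2 ^ (N + P - l) + j)%N
    <= (2 ^ (N + P - l))%:R * b l.
Proof.
move=> /andP[n0l lNP] kl; have [lN|Nl] := leqP l N.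
  have lD : (l - n0 <= D)%N by rewrite leq_subLR.
  have -> : (2 ^ (N + P - l) = 2 ^ (D - (l - n0)) * 2 ^ P)%N.
    by rewrite -expnD; congr (2 ^ _)%N; rewrite /N in lN *; lia.
  rewrite grid_block_sum natrM -mulrA (mulrCA (2 ^ _)%:R) ler_pM2l ?pow2_gt0//.
  by have := @f_le (l - n0) k lD; rewrite subnKC//; apply.
apply: (@le_trans _ _ (\sum_(j < 2 ^ (N + P - l)) b l)); last first.
  by rewrite sumr_const card_ord mulr_natl.
apply: ler_sum => j _; rewrite (@le_trans _ _ (b N))//; last first.
  by apply: (gauge_bound_nd hh); [exact: ltW | exact: ltnW].
apply: f_leaf; rewrite ltn_divLR ?expn_gt0// -expnD.
have -> : (2 ^ (N + P) = 2 ^ l * 2 ^ (N + P - l))%N by rewrite -expnD subnKC.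
by rewrite (@leq_trans (k.+1 * 2 ^ (N + P - l)))// ?leq_mul2r ?kl ?orbT// mulSnr ltn_add2l.
Qed.

Lemma grid_sum : \sum_(i < 2 ^ (N + P)) u i = (2 ^ (N + P))%:R * M.
Proof.
have E : (2 ^ (N + P) = 2 ^ n0 * (2 ^ D * 2 ^ P))%N by rewrite -!expnD addnA.
rewrite E (sum_blocks u) (eq_bigr (fun=> (2 ^ P)%:R * ((2 ^ D)%:R * M))).
  by rewrite sumr_const card_ord -[LHS]mulr_natl !natrM; ring.
by move=> k _; rewrite grid_block_sum f_sum.
Qed.

Lemma grid_block_eq k : (k < 2 ^ n0)%N ->
  \sum_(j < 2 ^ (N + P - n0)) u (k * 2 ^ (N + P - n0) + j)%N
    = (2 ^ (N + P - n0))%:R * M.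
Proof.
move=> kn; have -> : (2 ^ (N + P - n0) = 2 ^ D * 2 ^ P)%N.
  by rewrite -expnD; congr (2 ^ _)%N; rewrite /N; lia.
by rewrite grid_block_sum f_sum// natrM mulrA (mulrC (2 ^ P)%:R).
Qed.

End Grid.

(* Choosing the level [l] of the Harnack estimate so that [arc_length l] is
   comparable with the distance [d] to the circle makes the bound on the
   dyadic means available at that scale. *)
Lemma flow_polynomial (d eta : R) : 0 < d <= pi -> 0 < eta ->
  exists p : {poly R[i]}, [/\
    forall z, normc z < 1 -> normc p.[z] <=
      expR (36 * e * (h (1 - normc z) / (1 - normc z))),
    forall z, normc z < 1 -> normc (p.[z] - 1) <=
      expR (M * (8 * arc_length R n0 / (1 - normc z) ^+ 2) + eta) - 1,
    forall x, normc p.[cis x] <= expR (A + eta) &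
    forall k x, (k < 2 ^ N)%N ->
      2 * pi * k%:R / (2 ^ N)%:R + d <= x <=
        2 * pi * k.+1%:R / (2 ^ N)%:R - d ->
      normc p.[cis x] <= expR (f k - M + eta)].
Proof.
move=> /andP[d0 dpi] eta0.
have cd : cos d < 1.
  have := @ltr_cos R 0 d; rewrite !in_itv/= lexx pi_ge0 (ltW d0) dpi/=.
  by move=> /(_ isT isT); rewrite cos0 d0.
have cd0 : 0 < 1 - cos d by rewrite subr_gt0.
(* First the radius: close enough to 1 for foreign cells to contribute at most eta/8 at distance d
   from the endpoints. *)
have [r [r2 r1 rA]] : exists r : R, [/\ 2^-1 <= r, r < 1 &
    A * (2 * (1 - r) / (1 - cos d)) <= eta / 8].
  pose s := Num.min 2^-1 (eta / 8 * (1 - cos d) / (2 * (A + 1))).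
  have s0 : 0 < s.
    rewrite /s lt_min invr_gt0 ltr0n/= divr_gt0 ?mulr_gt0 ?divr_gt0 ?ltr0n//.
    by rewrite ltr_pwDr.
  exists (1 - s); split.
  - have : s <= 2^-1 by rewrite /s ge_min lexx.
    by lra.
  - by rewrite gtrBl.
  - have : s <= eta / 8 * (1 - cos d) / (2 * (A + 1)) by rewrite /s ge_min lexx orbT.
    have A1 : 0 < A + 1 by rewrite ltr_pwDr.
    rewrite ler_pdivlMr ?mulr_gt0 ?ltr0n// => sA.
    rewrite opprB addrC subrK mulrA ler_pdivrMr//.
    by nra.
have r0 : 0 < r by lra.
(* Then the number of nodes, since r^n has to beat 1 - r. The 9 is the largest Harnack factor in the
   coarse case below, the bound 1 serves the fine case, and the last condition provides a dyadic
   length below every 1 - r |z|. *)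
have [P [teP teA te1 dP]] : exists P, [/\
    9 * M * trunc_error (2 ^ (N + P)) r <= eta / 8,
    A * trunc_error (2 ^ (N + P)) r <= eta / 8,
    trunc_error (2 ^ (N + P)) r <= 1 &
    arc_length R (N + P) <= 1 - r].
  have te0 : trunc_error n r @[n --> \oo] --> 0.
    rewrite /trunc_error -[X in _ --> X](mul0r (1 - r)^-1); apply: cvgMl.
    rewrite -[X in _ --> X](mulr0 2); apply: cvgMr.
    by apply: cvg_expr; rewrite gtr0_norm.
  pose s := Num.min (eta / 8 / (9 * M + A + 1)) 1.
  have K0 : 0 < 9 * M + A + 1 by rewrite ltr_pwDr// addr_ge0// mulr_ge0.
  have s0 : 0 < s by rewrite lt_min ltr01 !divr_gt0.
  move/cvgrPdist_lt : te0 => /(_ _ s0) [n1 _ H1].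
  have r1' : 0 < 1 - r by rewrite subr_gt0.
  have /cvgrPdist_lt /(_ _ r1') [n2 _ H2] := @arc_length_cvg R.
  exists (n1 + n2)%N; set n := (2 ^ _)%N.
  have nn1 : (n1 <= n)%N.
    apply: (@leq_trans (N + (n1 + n2))%N); last exact/ltnW/ltn_expl.
    by rewrite (leq_trans (leq_addr n2 n1))// leq_addl.
  have te_ge0 := trunc_error_ge0 n r0 r1.
  have := H1 n nn1; rewrite /= sub0r normrN ger0_norm// => ts.
  have t1 : trunc_error n r <= 1 by rewrite ltW// (lt_le_trans ts)// /s ge_min lexx orbT.
  have : trunc_error n r <= eta / 8 / (9 * M + A + 1).
    by rewrite ltW// (lt_le_trans ts)// /s ge_min lexx.
  rewrite ler_pdivlMr// => tK.
  have tM : 0 <= trunc_error n r * M by rewrite mulr_ge0.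
  have tA : 0 <= trunc_error n r * A by rewrite mulr_ge0.
  split => //; [nra|nra|].
  have := H2 (N + (n1 + n2))%N; rewrite /= sub0r normrN.
  rewrite ger0_norm ?(ltW (arc_length_gt0 R _))// => H; apply/ltW/H.
  by rewrite (leq_trans (leq_addl n1 n2))// leq_addl.
set n := (2 ^ (N + P))%N in teP teA te1.
have n_gt0 : (0 < n)%N by rewrite expn_gt0.
have te0 := trunc_error_ge0 n r0 r1.
pose u i := f (i %/ 2 ^ P)%N.
have u0 i : 0 <= u i by have /andP[] := f_bnd (i %/ 2 ^ P)%N.
have uM : \sum_(i < n) u i = n%:R * M by exact: grid_sum.
(* Subtracting M makes the exponent nearly 0 inside the disk; the surplus eta/2 pays for the
   truncation and for the error eta/4 of the power polynomial. *)
pose g := exponent n r u (M + eta / 2).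
have eta4 : 0 < eta / 4 by rewrite divr_gt0.
have [p [p1 p2]] := power_poly_bounds g eta4.
have Rg z : normc z <= 1 ->
    complex.Re g.[z] + eta / 4 <= poisson_mean n r u z - M - eta / 8.
  move=> z1; have := Re_exponent_le n_gt0 r0 r1 u0 uM (M + eta / 2) z1.
  have tM : 0 <= M * trunc_error n r by rewrite mulr_ge0.
  by rewrite /g; lra.
exists p; split.
- move=> z z1; rewrite (le_trans (p1 _ (ltW z1)))// ler_expR.
  apply: (le_trans (Rg _ (ltW z1))).
  have z0 := normc_ge0 z.
  (* The estimates see the distance after dilation; as s >= 1 - |z| and h(x)/x is decreasing, a
     bound in terms of h(s)/s suffices. *)
  set s := 1 - r * normc z.
  have rz : r * normc z <= normc z by rewrite ler_piMl// ltW.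
  have s0 : 0 < s by rewrite /s; nra.
  have sz : 1 - normc z <= s by rewrite /s; lra.
  have z1' : 0 < 1 - normc z by rewrite subr_gt0.
  have rs : 1 - r <= s by rewrite /s; nra.
  have [_ mono _ dec _] := hh.
  apply: (@le_trans _ _ (36 * e * (h s / s))); last first.
    by rewrite ler_wpM2l ?dec// mulr_ge0// ltW.
  have hs0 : 0 <= h s by rewrite (gauge_ge0 hh)// ltW.
  have nE l : (l <= N + P)%N -> n = (2 ^ l * 2 ^ (N + P - l))%N.
    by move=> ln; rewrite -expnD subnKC.
  have n0NP : (n0 <= N + P)%N by rewrite /N -addnA leq_addr.
  have hs : 0 <= e * (h s / s) by rewrite mulr_ge0 ?divr_ge0// ltW.
  (* Coarse case: the means at level n0 are exactly M, so after subtracting M only the excess 8 y of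
     the Harnack factor over 1 remains, and M y <= e h(s)/s follows from M <= b n0. *)
  have [sn0|sn0] := leP (arc_length R n0) s.
    have gle k : (k < 2 ^ n0)%N -> \sum_(j < 2 ^ (N + P - n0))
        u (k * 2 ^ (N + P - n0) + j)%N <= (2 ^ (N + P - n0))%:R * M.
      by move=> kn; rewrite grid_block_eq.
    have := poisson_mean_le n_gt0 r0 r1 u0 (expn_gt0 2 n0) (expn_gt0 2 (N + P - n0))
      (nE _ n0NP) (ltW z1) (B := M) gle M_ge0.
    rewrite -/(arc_length R n0) -/s => H.
    set y := arc_length R n0 / s.
    have an0 := arc_length_gt0 R n0.
    have y0 : 0 < y by rewrite divr_gt0.
    have y1 : y <= 1 by rewrite ler_pdivrMr// mul1r.
    have My : M * y <= e * (h s / s).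
      have Ma : M * arc_length R n0 <= e * h (arc_length R n0).
        by move: M_le; rewrite /b /gauge_bound mulrA ler_pdivlMr.
      rewrite /y [leLHS]mulrA [leRHS]mulrA ler_wpM2r ?invr_ge0 ?(ltW s0)//.
      by rewrite (le_trans Ma)// ler_wpM2l ?(ltW e_gt0)// mono// ltW.
    have q9 : (1 + 2 * y) ^+ 2 <= 1 + 8 * y by nra.
    have q1 : M * (1 + 2 * y) ^+ 2 <= M + 8 * (M * y).
      have -> : M + 8 * (M * y) = M * (1 + 8 * y) by ring.
      by rewrite ler_wpM2l.
    have q2 : M * (M - M + (1 + 2 * y) ^+ 2) * trunc_error n r <= 9 * M * trunc_error n r.
      by rewrite subrr add0r ler_wpM2r// mulrC ler_wpM2r//; nra.
    rewrite subrr add0r in q2.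
    have ey : 2 * arc_length R n0 / s = 2 * y by rewrite /y mulrA.
    rewrite ey mulrDr mulr1 in H.
    by lra.
  have exl : exists l, arc_length R l <= s.
    by exists (N + P)%N; rewrite (le_trans dP).
  (* Fine case: the first level with arc length at most s, so s is less than twice that length. The
     Harnack factor is at most 9, the kernel mean at most 2, and b l <= 2 e h(s)/s, whence 36. *)
  pose l := ex_minn exl; have [sl minl] : arc_length R l <= s /\
      forall l', arc_length R l' <= s -> (l <= l')%N.
    by rewrite /l; case: ex_minnP => l' h1 h2.
  have lNP : (l <= N + P)%N by apply: minl; rewrite (le_trans dP).
  have n0l : (n0 < l)%N.
    rewrite ltnNge; apply/negP => ln; have := arc_length_le R ln.
    by rewrite leNgt (le_lt_trans sl).
  have n0lNP : (n0 <= l <= N + P)%N by rewrite (ltnW n0l).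
  have sl2 : s < 2 * arc_length R l.
    rewrite -(prednK (leq_ltn_trans (leq0n _) n0l)) -arc_lengthS ltNge.
    by apply/negP => /minl; rewrite leqNgt ltn_predL (leq_ltn_trans (leq0n _) n0l).
  have b0 : 0 <= b l by rewrite (gauge_bound_ge0 hh)// ltW.
  have := poisson_mean_le n_gt0 r0 r1 u0 (expn_gt0 2 l) (expn_gt0 2 (N + P - l))
      (nE _ lNP) (ltW z1) (fun k kl => grid_block_le n0lNP kl) b0.
  rewrite -/(arc_length R l) -/s; set y := 2 * _ / s; rewrite -(mulrA (b l)) => H.
  have al0 := arc_length_gt0 R l.
  have y0 : 0 < y by rewrite divr_gt0// mulr_gt0.
  have y2 : y <= 2 by rewrite ler_pdivrMr// ler_wpM2l.
  have q : (1 + y) ^+ 2 * (1 + trunc_error n r) <= 18.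
    by apply: (@le_trans _ _ (9 * 2)); [apply: ler_pM => //; nra | lra].
  have bl : b l <= 2 * (e * (h s / s)).
    set t := h s / s; have st : h s = t * s by rewrite /t divfK// gt_eqF.
    have t0 : 0 <= t by rewrite divr_ge0// ltW.
    have ht : h (arc_length R l) / arc_length R l <= 2 * t.
      rewrite ler_pdivrMr// (le_trans (mono _ _ (ltW al0) sl))// st.
      by have := ler_wpM2l t0 (ltW sl2); lra.
    by have := ler_wpM2l (ltW e_gt0) ht; rewrite /b /gauge_bound; lra.
  have H18 := le_trans H (ler_wpM2l b0 q); rewrite -mulrA.
  have M0 := M_ge0; move: H18 bl M0 eta0; clear.
  move: (poisson_mean _ _ _ _) (b l) (e * (h s / s)) => a1 a2 a3.
  by lra.
- move=> z z1; rewrite (le_trans (p2 z))// lerD2r ler_expR.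
  have n0NP : (n0 <= N + P)%N by rewrite /N -addnA leq_addr.
  have nE : n = (2 ^ n0 * 2 ^ (N + P - n0))%N by rewrite -expnD subnKC.
  have := exponent_small n_gt0 r0 r1 u0 uM (expn_gt0 2 n0) (expn_gt0 2 (N + P - n0))
    nE (M + eta / 2) z1 (fun k kn => grid_block_eq P kn).
  rewrite -/g -/(arc_length R n0) => H.
  have E : g.[z] = (g.[z] - (M - (M + eta / 2))%:C) + (M - (M + eta / 2))%:C by ring.
  rewrite E (le_trans (le_normcD _ _))// (le_trans (lerD H (lexx _)))// normcR.
  rewrite opprD addrA subrr sub0r normrN ger0_norm ?divr_ge0 ?(ltW eta0)//.
  have tM : 0 <= M * trunc_error n r by rewrite mulr_ge0.
  by rewrite mulrDr; lra.
- move=> x; have c1 : normc (cis x) <= 1 by rewrite normc_cis.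
  rewrite (le_trans (p1 _ c1))// ler_expR (le_trans (Rg _ c1))//.
  have : poisson_mean n r u (cis x) <= A * (1 + trunc_error n r).
    have nR : (0 : R) < n%:R by rewrite ltr0n.
    rewrite /poisson_mean ler_pdivrMr//.
    apply: (@le_trans _ _ (A * \sum_(i < n) poisson (pull n r (cis x) i))).
      rewrite mulr_sumr; apply: ler_sum => i _; apply: ler_wpM2r; last first.
        by have /andP[] := f_bnd (i %/ 2 ^ P)%N.
      by rewrite poisson_ge0// normc_pull// normc_cis mulr1 ltW.
    rewrite -mulrA; apply: ler_wpM2l => //; rewrite -(ler_pdivrMr _ _ nR).
    by have := mean_poisson_error n_gt0 r0 r1 c1; rewrite ler_norml => /andP[_]; rewrite lerBlDl.
  rewrite mulrDr mulr1; have M0 := M_ge0; move: teA M0 eta0.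
  move: (poisson_mean _ _ _ _) (A * _) => a1 a2.
  by lra.
- move=> k x kN hx; have c1 : normc (cis x) <= 1 by rewrite normc_cis.
  rewrite (le_trans (p1 _ c1))// ler_expR (le_trans (Rg _ c1))//.
  have dd : 0 < d <= pi by rewrite d0.
  have := poisson_mean_boundary (expn_gt0 2 N) (expn_gt0 2 P) r2 r1 dd f_bnd kN hx.
  rewrite -expnD -/n -/u mulrDr mulr1.
  have /andP[fk0 fkA] := f_bnd k.
  have := le_trans (ler_wpM2r te0 fkA) teA; move: rA eta0.
  move: (poisson_mean _ _ _ _) (A * _) (f k * _) => a1 a2 a3.
  by lra.
Qed.

End FlowPolynomial.

(** * Dyadic cells of the line and step functions on them *)

Section DyadicCells.
Variable R : realType.
Local Notation mu := (@lebesgue_measure R).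
Local Notation arc := (arc_length R).

Definition cell (l k : nat) : set R := `[arc l * k%:R, arc l * k.+1%:R[.

Definition cell_index (l : nat) (x : R) : nat := Num.truncn (x / arc l).

Lemma measurable_cell l k : measurable (cell l k).
Proof. exact: measurable_itv. Qed.

Lemma cell_ge0 l k x : cell l k x -> 0 <= x.
Proof.
rewrite /cell /= in_itv/= => /andP[+ _]; apply: le_trans.
by rewrite mulr_ge0// ltW// arc_length_gt0.
Qed.

Lemma cellP l k x : 0 <= x -> cell l k x <-> cell_index l x = k.
Proof.
move=> x0; rewrite /cell /= in_itv/= /cell_index.
have a0 := arc_length_gt0 R l.
have xa0 : 0 <= x / arc l by rewrite divr_ge0// ltW.
split=> [/andP[h1 h2]|<-].
  by apply: truncn_def; rewrite ler_pdivlMr// ltr_pdivrMr// mulrC h1 mulrC.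
have /andP[h1 h2] := truncn_itv xa0.
by rewrite mulrC -ler_pdivlMr// h1/= mulrC -ltr_pdivrMr.
Qed.

Lemma cell00 : cell 0 0 = `[0, 2 * pi[%classic.
Proof. by rewrite /cell mulr0 mulr1 /arc_length expn0 divr1. Qed.

Lemma cell_index_lt l x : cell 0 0 x -> (cell_index l x < 2 ^ l)%N.
Proof.
rewrite cell00 /= in_itv/= => /andP[x0 x2].
have a0 := arc_length_gt0 R l.
have xa : 0 <= x / arc l by rewrite divr_ge0// ltW.
rewrite /cell_index truncn_lt_nat// ltr_pdivrMr//.
by rewrite /arc_length mulrC divfK ?gt_eqF ?pow2_gt0.
Qed.

Lemma cell_index_div l d x : 0 <= x ->
  (cell_index (l + d) x %/ 2 ^ d)%N = cell_index l x.
Proof.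
move=> x0; apply/esym/cellP => //.
have /(cellP (l + d) (cell_index (l + d) x) x0) : cell_index (l + d) x = cell_index (l + d) x by [].
set k := cell_index _ _; rewrite /cell /= !in_itv/= => /andP[h1 h2].
have E : arc l = arc (l + d) * (2 ^ d)%:R.
  rewrite /arc_length expnD natrM; field.
  by rewrite !gt_eqF ?pow2_gt0.
have a0 := arc_length_gt0 R (l + d).
rewrite E -!(mulrA (arc (l + d))) -!natrM; apply/andP; split.
  by rewrite (le_trans _ h1)// ler_pM2l// ler_nat mulnC leq_trunc_div.
rewrite (lt_le_trans h2)// ler_pM2l// ler_nat mulnC.
by rewrite ltn_ceil ?expn_gt0.
Qed.

Lemma cell_split l k : cell l k = cell l.+1 k.*2 `|` cell l.+1 k.*2.+1.
Proof.
have e1 : arc l * k%:R = arc l.+1 * (k.*2)%:R.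
  by rewrite arc_lengthS -muln2 natrM; ring.
have e2 : arc l * k.+1%:R = arc l.+1 * (k.*2.+2)%:R.
  by rewrite arc_lengthS -doubleS -muln2 natrM; ring.
have a0 := arc_length_gt0 R l.+1.
have m1 : arc l.+1 * (k.*2)%:R <= arc l.+1 * (k.*2.+1)%:R.
  by rewrite ler_pM2l// ler_nat.
have m2 : arc l.+1 * (k.*2.+1)%:R <= arc l.+1 * (k.*2.+2)%:R.
  by rewrite ler_pM2l// ler_nat.
rewrite /cell e1 e2; apply/seteqP; split => x /=; rewrite !in_itv/=.
  move=> /andP[h1 h2]; have [h|h] := ltP x (arc l.+1 * (k.*2.+1)%:R).
    by left; rewrite h1.
  by right; exact/andP.
move=> [/andP[h1 h2]|/andP[h1 h2]].
  by rewrite h1 (lt_le_trans h2).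
by rewrite h2 andbT (le_trans m1).
Qed.

Lemma cell_disj l k k' : k != k' -> [disjoint cell l k & cell l k'].
Proof.
move=> kk'; apply/disj_setPS => x [h1 h2].
have x0 := cell_ge0 h1.
by move/(cellP _ _ x0) : h1 => h1; move/(cellP _ _ x0) : h2 => h2;
   rewrite -h1 -h2 eqxx in kk'.
Qed.

Lemma mu_cell l k : mu (cell l k) = (arc l)%:E.
Proof.
rewrite /cell lebesgue_measure_itv/= lte_fin ltr_pM2l ?arc_length_gt0// ltr_nat.
by rewrite ltnSn -EFinD -natr1 mulrDr mulr1 addrAC subrr add0r.
Qed.

Lemma measurable_step (F : nat -> R) l D :
  measurable_fun D (fun x => F (cell_index l x)).
Proof.
have mi : measurable_fun setT (fun x => (cell_index l x)%:R : R).
  apply: nondecreasing_measurable => // x y xy; rewrite ler_nat le_truncn//.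
  by rewrite ler_wpM2r ?invr_ge0// ltW// arc_length_gt0.
apply: (@measurable_funS _ _ _ _ setT) => // _ Y mY; rewrite setTI.
rewrite (_ : _ @^-1` Y = \bigcup_(k in [set k | Y (F k)])
   ((fun x => (cell_index l x)%:R : R) @^-1` [set k%:R])); last first.
  apply/seteqP; split => [x /= Yx|x [k /= Yk /eqP]].
    by exists (cell_index l x).
  by rewrite eqr_nat => /eqP ->.
apply: bigcup_measurable => k _; rewrite -[X in measurable X]setTI.
exact: mi.
Qed.

Lemma integral_step (F : nat -> R) d l k : (forall i, 0 <= F i) ->
  (\int[mu]_(x in cell l k) (F (cell_index (l + d) x))%:E =
  (arc (l + d) * \sum_(j < 2 ^ d) F (k * 2 ^ d + j)%N)%:E)%E.
Proof.
move=> F0; elim: d l k => [|d IH] l k.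
  rewrite addn0 big_ord1 muln1 addn0.
  rewrite (eq_integral (fun=> (F k)%:E)) => [|x /set_mem kx].
    rewrite integral_cst; last exact: measurable_cell.
    by rewrite [X in (_ * X)%E]mu_cell -EFinM mulrC.
  by rewrite ((cellP _ _ (cell_ge0 kx)).1 kx).
rewrite {1}cell_split ge0_integral_setU//=.
- by rewrite addnS -addSn !IH -EFinD -mulrDr -sum_dyadic_split.
- exact: measurable_cell.
- exact: measurable_cell.
- by apply/measurable_EFinP; exact: measurable_step.
- by move=> x _; rewrite lee_fin.
- by apply: cell_disj; rewrite neq_ltn ltnSn.
Qed.

End DyadicCells.

(** * Dyadic averages of the weight and Lebesgue differentiation *)

Section CellAverages.
Variables (R : realType) (W : R -> R).
Local Notation mu := (@lebesgue_measure R).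
Local Notation arc := (arc_length R).
Hypothesis W_ge0 : forall x, 0 <= W x.
Hypothesis W_int : mu.-integrable (@cell R 0 0) (EFin \o W).

(** Extension by zero off the fundamental interval: it is integrable on the whole line, and averages
    over all cells make sense. *)
Let w0 := W \_ (@cell R 0 0).

Let w0_ge0 x : 0 <= w0 x.
Proof. by rewrite /w0 patchE; case: ifP. Qed.

Let w0_int : mu.-integrable setT (EFin \o w0).
Proof.
rewrite -restrict_EFin; apply: (iffLR (integrable_mkcond _ _)).
  exact: measurable_cell.
exact: W_int.
Qed.

Definition cell_avg l k : R :=
  fine (\int[mu]_(x in @cell R l k) (w0 x)%:E)%E / arc l.

Let w0_fin l k : (\int[mu]_(x in @cell R l k) (w0 x)%:E)%E \is a fin_num.
Proof.
apply: integrable_fin_num; first exact: measurable_cell.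
by apply: (integrableS _ _ _ w0_int) => //; exact: measurable_cell.
Qed.

Lemma cell_avgE l k :
  (\int[mu]_(x in @cell R l k) (w0 x)%:E = (arc l * cell_avg l k)%:E)%E.
Proof.
by rewrite /cell_avg mulrC divfK ?gt_eqF ?arc_length_gt0// fineK// w0_fin.
Qed.

Lemma cell_avg_integral l k : (k < 2 ^ l)%N ->
  (\int[mu]_(x in @cell R l k) (W x)%:E = (arc l * cell_avg l k)%:E)%E.
Proof.
move=> kl; rewrite -cell_avgE; apply: eq_integral => x /set_mem kx.
rewrite /w0 patchE mem_set//.
apply/(cellP 0 0 (cell_ge0 kx)); rewrite -(cell_index_div 0 l (cell_ge0 kx)).
by rewrite add0n ((cellP _ _ (cell_ge0 kx)).1 kx) divn_small.
Qed.

Lemma cell_avg_ge0 l k : 0 <= cell_avg l k.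
Proof.
rewrite divr_ge0 ?(ltW (arc_length_gt0 R l))// fine_ge0// integral_ge0// => x _.
by rewrite lee_fin.
Qed.

Lemma cell_avg_split l k :
  cell_avg l k = (cell_avg l.+1 k.*2 + cell_avg l.+1 k.*2.+1) / 2.
Proof.
have a0 := arc_length_gt0 R l.+1.
suff : arc l * cell_avg l k =
    arc l.+1 * cell_avg l.+1 k.*2 + arc l.+1 * cell_avg l.+1 k.*2.+1.
  move=> H; have nz : arc l != 0 by rewrite gt_eqF ?arc_length_gt0.
  by apply: (mulfI nz); rewrite H [arc l]arc_lengthS; field.
apply: EFin_inj; rewrite EFinD -!cell_avgE {1}cell_split ge0_integral_setU//=.
- exact: measurable_cell.
- exact: measurable_cell.
- by apply: measurable_funTS; have /integrableP[] := w0_int.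
- by move=> x _; rewrite lee_fin.
- by apply: cell_disj; rewrite neq_ltn ltnSn.
Qed.

(** The dyadic cell around any real x, negative ones included, hence the floor. *)
Let nbhd (x : R) (l : nat) : set R :=
  `[arc l * (Num.floor (x / arc l))%:~R,
    arc l * (Num.floor (x / arc l) + 1)%:~R[.

Let nbhd_cell x l : 0 <= x -> nbhd x l = cell l (cell_index l x).
Proof.
move=> x0; rewrite /nbhd /cell /cell_index.
have : 0 <= x / arc l by rewrite divr_ge0// ltW// arc_length_gt0.
move=> xa0; have fl0 : 0 <= Num.floor (x / arc l) by rewrite floor_ge0.
rewrite truncn_floor xa0 -[in LHS](gez0_abs fl0).
by rewrite intrD1 -!pmulrn natr1.
Qed.

(** The cells around x shrink nicely: each lies in the ball of radius [arc l], whose measure is only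
    twice that of the cell. *)
Lemma cell_avg_cvg : {ae mu, forall x, @cell R 0 0 x ->
  cell_avg l (cell_index l x) @[l --> \oo] --> W x}.
Proof.
have sh x : nicely_shrinking x (nbhd x).
  split; first by move=> l; exact: measurable_itv.
  exists (2, fun l => PosNum (arc_length_gt0 R l)); split => //=.
  - exact: arc_length_cvg.
  - move=> l y; rewrite /nbhd /= in_itv/= /ball/= => /andP[y1 y2].
    have a0 := arc_length_gt0 R l.
    have /andP[x1 x2] := floor_itv (x / arc l).
    rewrite ler_pdivlMr// mulrC in x1; rewrite ltr_pdivrMr// mulrC in x2.
    move: y2 x2; rewrite intrD1 mulrDr mulr1 => y2 x2.
    by rewrite ltr_norml; apply/andP; split; lra.
  - move=> l; rewrite lebesgue_measure_ball ?(ltW (arc_length_gt0 R l))//.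
    rewrite /nbhd lebesgue_measure_itv/= lte_fin ltr_pM2l ?arc_length_gt0//.
    rewrite ltr_int ltrDl ltr01 -EFinD -EFinM lee_fin intrD1.
    have -> (y z : R) : y * (z + 1) - y * z = y by ring.
    by rewrite mulr_natl.
have loc : locally_integrable setT w0.
  by apply: open_integrable_locally; [exact: openT | exact: w0_int].
have := lebesgue_differentiation loc.
apply: negligibleS => x /= nP px; apply: nP => xc.
have x0 := cell_ge0 xc.
have := nice_lebesgue_differentiation sh loc px.
have -> : w0 x = W x by rewrite /w0 patchE mem_set.
rewrite (_ : (fun n => _) = (EFin \o (fun l => cell_avg l (cell_index l x)))).
  by move/fine_cvg.
apply: funext => l /=; rewrite nbhd_cell// mu_cell cell_avgE inver gt_eqF ?arc_length_gt0//.
by rewrite -EFinM mulKf// gt_eqF ?arc_length_gt0.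
Qed.

End CellAverages.

(** * Leaf values given by the weight, and the limit of the traces *)

Section WeightCapacity.
Variables (R : realType) (W : R -> R) (b : nat -> R).
Local Notation mu := (@lebesgue_measure R).
Local Notation arc := (arc_length R).
Hypothesis W_ge0 : forall x, 0 <= W x.
Hypothesis W_int : mu.-integrable (@cell R 0 0) (EFin \o W).
Hypothesis b_ge0 : forall l, 0 <= b l.
Hypothesis b_nd : forall l l', (l <= l')%N -> b l <= b l'.
Hypothesis b_cvg : b l @[l --> \oo] --> +oo.

(* The shift by [expR (- b l)] keeps [leaf l k] below [b l] while preserving
   its convexity in the average, which makes the capacities monotone. *)
Definition leaf l k : R :=
  Num.max 0 (- ln (cell_avg W l k + expR (- b l))).

Lemma leaf_ge0 l k : 0 <= leaf l k.
Proof. by rewrite le_max lexx. Qed.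

Let shift_gt0 l k : 0 < cell_avg W l k + expR (- b l).
Proof. by rewrite ltr_wpDl ?cell_avg_ge0 ?expR_gt0. Qed.

Lemma leaf_le l k : leaf l k <= b l.
Proof.
rewrite ge_max b_ge0/= lerNl -[leLHS]expRK ler_ln ?posrE ?expR_gt0//.
by rewrite lerDr cell_avg_ge0.
Qed.

(** Convexity of -ln, in the form of the inequality between geometric and arithmetic means. The
    shift decreases with the level, which only helps. *)
Lemma leaf_avg l k : leaf l k <= (leaf l.+1 k.*2 + leaf l.+1 k.*2.+1) / 2.
Proof.
rewrite {1}/leaf ge_max divr_ge0 ?addr_ge0 ?leaf_ge0//=.
set s := expR (- b l.+1).
set x := cell_avg W l.+1 k.*2 + s; set y := cell_avg W l.+1 k.*2.+1 + s.
have x0 : 0 < x by exact: shift_gt0.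
have y0 : 0 < y by exact: shift_gt0.
apply: (@le_trans _ _ ((- ln x - ln y) / 2)); last first.
  by rewrite ler_pM2r ?invr_gt0// lerD// le_max lexx orbT.
have sb : s <= expR (- b l) by rewrite ler_expR lerN2 b_nd.
have z0 : 0 < (x + y) / 2 by rewrite divr_gt0// addr_gt0.
have -> : (- ln x - ln y) / 2 = - (ln (x * y) / 2).
  by rewrite lnM ?posrE//; ring.
rewrite lerN2 ler_pdivrMr//.
have -> : ln (cell_avg W l k + expR (- b l)) * 2
    = ln ((cell_avg W l k + expR (- b l)) ^+ 2).
  by rewrite lnXn ?shift_gt0// mulr_natr.
rewrite ler_ln ?posrE ?mulr_gt0// ?exprn_gt0 ?shift_gt0//.
have amgm (p q : R) : p * q <= ((p + q) / 2) ^+ 2.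
  rewrite -subr_ge0 (_ : _ - _ = ((p - q) / 2) ^+ 2) ?sqr_ge0//.
  by field.
apply: (le_trans (amgm x y)).
rewrite lerXn2r ?nnegrE ?(ltW z0) ?(ltW (shift_gt0 _ _))//.
by rewrite (cell_avg_split W_ge0 W_int) /x /y; lra.
Qed.

(** When positive, the leaf value is the logarithm of the inverse of the shifted average; otherwise
    it is 0. This bounds the weighted integral of the exponential of a flow. *)
Lemma expR_leaf l k : expR (leaf l k) * cell_avg W l k <= 1 + cell_avg W l k.
Proof.
have a0 := cell_avg_ge0 W_ge0 l k.
rewrite /leaf; have [h|h] := leP 0 (- ln (cell_avg W l k + expR (- b l))).
  rewrite expRN lnK ?posrE// mulrC ler_pdivrMr// mulrDl mul1r.
  have := expR_gt0 (- b l); nra.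
by rewrite expR0 mul1r lerDr.
Qed.

Lemma leaf_cvg x : @cell R 0 0 x ->
  cell_avg W l (cell_index l x) @[l --> \oo] --> W x ->
  ((leaf l (cell_index l x))%:E @[l --> \oo] --> maxe (- lne (W x)%:E) 0)%E.
Proof.
move=> xc xW.
have s0 : expR (- b l) @[l --> \oo] --> 0.
  exact: (cvg_comp _ _ b_cvg (@cvgr_expR R)).
have yW : cell_avg W l (cell_index l x) + expR (- b l) @[l --> \oo] --> W x.
  by rewrite -[X in _ --> X]addr0; exact: cvgD.
have := W_ge0 x; rewrite le_eqVlt => /orP[/eqP Wx|Wx].
  rewrite -Wx le0_lneNy//= maxye.
  apply/cvgeyPge => A; rewrite -Wx in yW.
  move/cvgrPdist_lt : yW => /(_ (expR (- A)) (expR_gt0 _)).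
  apply: filterS => l; rewrite sub0r normrN gtr0_norm ?shift_gt0// => h.
  rewrite lee_fin le_max; apply/orP; right.
  by rewrite lerNr -[leRHS]expRK ler_ln ?posrE ?shift_gt0 ?expR_gt0// ltW.
rewrite lne_EFin// -EFinN -EFin_max; apply: cvg_EFin; first by apply: nearW.
rewrite (_ : _ \o _ = fun l : nat => Num.max 0
  (- ln (cell_avg W l (cell_index l x) + expR (- b l))))// maxC.
have lnW : - ln (cell_avg W l (cell_index l x) + expR (- b l)) @[l --> \oo] --> - ln (W x).
  by apply: cvgN; exact: (cvg_comp _ _ yW (continuous_ln Wx)).
under eq_cvg do rewrite maxr_absE; rewrite maxr_absE.
apply: cvgM; last exact: cvg_cst.
apply: cvgD; first by apply: cvgD => //; exact: cvg_cst.
by apply: cvg_norm; apply: cvgD; [exact: cvg_cst | exact: cvgN].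
Qed.

Variable n0 : nat.

Local Notation cap := (limit_capacity b leaf).
Local Notation sat := (saturated b leaf).

(** A lower limit, so that Fatou's lemma applies. On the fundamental interval it turns out to be
    [b l] on a first saturated cell of level [l], and the positive part of -log W at almost every
    point that no saturated cell contains. *)
Definition trace_limit (x : R) : \bar R :=
  limn_einf (fun d => (trace b leaf d n0 (cell_index (n0 + d) x))%:E).

Lemma trace_limit_ge0 x : (0 <= trace_limit x)%E.
Proof.
rewrite /trace_limit limn_einf_lim; apply: lime_ge.
  exact: is_cvg_einfs.
apply: nearW => d; apply: le_ereal_inf_tmp => _ [m _ <-].
by rewrite lee_fin trace_ge0//; [exact: leaf_ge0 | exact: leaf_le].
Qed.

Lemma measurable_trace_limit D : measurable_fun D trace_limit.
Proof.
apply: (@measurable_funS _ _ _ _ setT) => //.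
have mesup : measurable_fun setT (fun x : R => limn_esup
    (fun d => (- (trace b leaf d n0 (cell_index (n0 + d) x)))%:E)).
  apply: (@measurable_fun_limn_esup _ _ _ _
    (fun d x => (- (trace b leaf d n0 (cell_index (n0 + d) x)))%:E)) => d.
  apply/measurable_EFinP.
  exact: (@measurable_step R (fun k => - trace b leaf d n0 k) (n0 + d) setT).
have mN : measurable_fun setT (-%E \o (fun x : R => limn_esup
    (fun d => (- (trace b leaf d n0 (cell_index (n0 + d) x)))%:E))).
  exact: measurableT_comp.
exact: mN.
Qed.

(** Fatou's lemma applied to the mass balance [sum_trace_le] at every finite depth. *)
Lemma integral_trace_limit k :
  (\int[mu]_(x in cell n0 k) trace_limit x <= (arc n0 * cap n0 k)%:E)%E.
Proof.
have tr0 d l i : 0 <= trace b leaf d l i.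
  by apply: trace_ge0; [exact: leaf_ge0 | exact: leaf_le].
apply: (@le_trans _ _ (limn_einf (fun d => \int[mu]_(x in cell n0 k)
    (trace b leaf d n0 (cell_index (n0 + d) x))%:E)%E)).
  apply: fatou; first exact: measurable_cell.
    by move=> d; apply/measurable_EFinP; exact: measurable_step.
  by move=> d x _; rewrite lee_fin.
rewrite limn_einf_lim; apply: lime_le; first exact: is_cvg_einfs.
apply: nearW => d; apply: (@le_trans _ _ (\int[mu]_(x in cell n0 k)
    (trace b leaf d n0 (cell_index (n0 + d) x))%:E)%E).
  by apply: ereal_inf_lbound; exists d => /=.
rewrite integral_step// lee_fin.
have -> : arc n0 = arc (n0 + d) * 2 ^+ d.
  rewrite -natrX /arc_length expnD natrM; field.
  by rewrite !gt_eqF ?pow2_gt0.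
rewrite -mulrA ler_pM2l ?arc_length_gt0//.
by apply: sum_trace_le; [exact: leaf_le | exact: leaf_avg].
Qed.

Lemma trace_hit d l k i : (i <= d)%N ->
  (forall j, (j < i)%N -> ~~ sat (l + j) (k %/ 2 ^ (d - j))) ->
  sat (l + i) (k %/ 2 ^ (d - i)) -> trace b leaf d l k = b (l + i).
Proof.
elim: d l i => [|d IH] l [|i]//= id.
- by move=> _; rewrite addn0 => ->.
- by move=> _; rewrite addn0 subn0 => ->.
- move=> ns si; have := ns 0%N isT; rewrite addn0 subn0 => /negbTE ->.
  rewrite addnS -addSn; apply: (IH l.+1 i) => //; last by rewrite addSn -addnS.
  by move=> j ji; have := ns j.+1 ji; rewrite addSn -addnS subSS.
Qed.

Lemma trace_free d l k :
  (forall j, (j <= d)%N -> ~~ sat (l + j) (k %/ 2 ^ (d - j))) ->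
  trace b leaf d l k = leaf (l + d) k.
Proof.
elim: d l => [|d IH] l ns /=; have := ns 0%N isT; rewrite addn0 subn0.
  by move=> /negbTE ->.
move=> /negbTE ->; rewrite IH ?addSnnS// => j jd.
by have := ns j.+1 jd; rewrite addSnnS subSS.
Qed.

Definition first_saturated (l : nat) (x : R) : Prop :=
  [/\ (n0 <= l)%N, sat l (cell_index l x) &
   forall l', (n0 <= l' < l)%N -> ~~ sat l' (cell_index l' x)].

Definition never_saturated (x : R) : Prop :=
  forall l, (n0 <= l)%N -> ~~ sat l (cell_index l x).

Lemma first_saturated_or_never x :
  (exists l, first_saturated l x) \/ never_saturated x.
Proof.
have [[l [nl sl]]|H] := pselect (exists l, (n0 <= l)%N /\ sat l (cell_index l x)).
  left; have ex : exists l, (n0 <= l)%N && sat l (cell_index l x).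
    by exists l; rewrite nl.
  case: (ex_minnP ex) => m /andP[nm sm] minm; exists m; split => // l' /andP[nl' lm].
  by apply/negP => s; have := minm l'; rewrite nl' s => /(_ isT); rewrite leqNgt lm.
by right=> l nl; apply/negP => s; apply: H; exists l.
Qed.

Let index_div i d (x : R) : 0 <= x -> (i <= d)%N ->
  (cell_index (n0 + d) x %/ 2 ^ (d - i))%N = cell_index (n0 + i) x.
Proof.
move=> x0 id; have := cell_index_div (n0 + i) (d - i) x0.
by rewrite -addnA subnKC.
Qed.

Lemma trace_limit_saturated l x : 0 <= x -> first_saturated l x ->
  trace_limit x = (b l)%:E.
Proof.
move=> x0 [nl sl ns]; rewrite /trace_limit.
suff : (trace b leaf d n0 (cell_index (n0 + d) x))%:E @[d --> \oo] --> (b l)%:E.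
  by move/cvg_limn_einf_sup => [].
apply: cvg_near_cst; exists (l - n0)%N => // d /= ld.
rewrite (@trace_hit _ _ _ (l - n0)%N)// ?subnKC//.
- move=> j jl; rewrite index_div ?(ltnW (leq_trans jl ld))//.
  by apply: ns; rewrite leq_addr/= -ltn_subRL.
- by rewrite index_div// subnKC.
Qed.

Lemma trace_limit_never : {ae mu, forall x, @cell R 0 0 x -> never_saturated x ->
  (trace_limit x = maxe (- lne (W x)%:E) 0)%E}.
Proof.
have := cell_avg_cvg W_int; apply: negligibleS => x /= nP cv.
apply: nP => xc ns; have x0 := cell_ge0 xc; have {}cv := leaf_cvg xc (cv xc).
rewrite /trace_limit.
suff : ((trace b leaf d n0 (cell_index (n0 + d) x))%:E @[d --> \oo]
    --> maxe (- lne (W x)%:E) 0)%E.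
  by move/cvg_limn_einf_sup => [].
rewrite (_ : (fun d => _) =
  (fun d => (leaf (d + n0) (cell_index (d + n0) x))%:E)); last first.
  apply: funext => d; rewrite (addnC d n0) trace_free// => j jd.
  by rewrite index_div//; apply: ns; rewrite leq_addr.
by rewrite (cvg_shiftn n0 (fun l => (leaf l (cell_index l x))%:E)).
Qed.

End WeightCapacity.

(** * The circle parametrised by [0, 2 pi) *)

Section CircleParametrization.
Variable R : realType.
Local Notation mu := (@lebesgue_measure R).

Let expi_cis (x : R) : expi x = cis x. Proof. by []. Qed.

Lemma circle_expi (x : R) : circle R (expi x).
Proof. exact: normc_cis. Qed.

Lemma expi_inj (x y : R) : @cell R 0 0 x -> @cell R 0 0 y ->
  expi x = expi y -> x = y.
Proof.
rewrite cell00 /= !in_itv/=.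
wlog xy : x y / x <= y => [H|] /andP[x0 x2] /andP[y0 y2] e.
  have [xy|/ltW yx] := leP x y; first by apply: H => //; apply/andP.
  by apply/esym; apply: H => //; apply/andP.
apply: contrapT => /eqP ne.
have lt : x < y by rewrite lt_neqAle ne.
have := @cis_neq1 R (y - x); rewrite subr_gt0 lt/=.
have -> : y - x < 2 * pi by lra.
move=> /(_ isT) /eqP; apply.
have e' : cis y = cis x by [].
by rewrite cisD e' -cisD subrr cis0.
Qed.

Lemma expi_surj (z : R[i]) : circle R z -> exists2 x : R, @cell R 0 0 x & z = expi x.
Proof.
case: z => a b /(congr1 (fun u => u ^+ 2)); rewrite normc_sqr expr1n /= => ab.
have a1 : -1 <= a <= 1.
  by rewrite -ler_norml -(ler_pXn2r (ltn0Sn 1)) ?nnegrE// real_normK ?num_real//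
    expr1n -ab lerDl sqr_ge0.
have c := acosK (x := a); rewrite in_itv/= in c.
have p0 := @pi_gt0 R.
have b2 : sin (acos a) ^+ 2 = b ^+ 2 by rewrite sin2cos2 c// -ab addrAC subrr add0r.
have [b0|b0] := leP 0 b.
  exists (acos a).
    rewrite cell00 /= in_itv/= acos_ge0//= (le_lt_trans (acos_lepi a1))//; lra.
  rewrite /expi c//; congr (_ +i* _); apply/eqP.
  rewrite -(eqrXn2 (ltn0Sn 1)) ?b2// sin_ge0_pi// acos_ge0// acos_lepi//.
have sp : 0 < sin (acos a).
  rewrite lt_neqAle sin_ge0_pi ?acos_ge0 ?acos_lepi// andbT eq_sym.
  by rewrite -sqrf_eq0 b2 sqrf_eq0 lt_eqF.
have ac0 : 0 < acos a.
  rewrite lt_neqAle acos_ge0// andbT; apply/eqP => e.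
  by rewrite -e sin0 ltxx in sp.
exists (2 * pi - acos a).
  rewrite cell00 /= in_itv/=; have := acos_lepi a1 => h; apply/andP; split; lra.
rewrite /expi cosB sinB !mulr_natl cos2pi sin2pi c// !mul1r !mul0r addr0 sub0r.
congr (_ +i* _); apply: oppr_inj; rewrite opprK; apply/eqP.
by rewrite -(eqrXn2 (ltn0Sn 1)) ?sqrrN ?b2 ?(ltW sp)// oppr_ge0 ltW.
Qed.

Lemma closed_expi_itv (a c : R) : closed (@expi R @` `[a, c] : set (R[i])^o).
Proof.
apply: compact_closed; first exact: norm_hausdorff.
apply: continuous_compact; last exact: segment_compact.
by apply: continuous_subspaceT => x; exact: continuous_expi.
Qed.

Lemma connected_expi_itv (i : interval R) :
  connected (@expi R @` [set` i] : set (R[i])^o).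
Proof.
apply: connected_continuous_connected.
  by apply/connected_intervalP/interval_is_interval.
by apply: continuous_subspaceT => x; exact: continuous_expi.
Qed.

Lemma open_measurableC (A : set (R[i])^o) : open A -> measurable (A : set (borelC R)).
Proof. by move=> oA; exact: sub_sigma_algebra. Qed.

Lemma closed_measurableC (A : set (R[i])^o) : closed A -> measurable (A : set (borelC R)).
Proof.
move=> cA; rewrite -(setCK A); apply: measurableC; apply: open_measurableC.
exact: closed_openC.
Qed.

Lemma closed_circle : closed (circle R).
Proof.
have -> : circle R = @expi R @` `[0, 2 * pi].
  apply/seteqP; split => [z /expi_surj[x + ->]|z [x _ <-]]; last exact: circle_expi.
  rewrite cell00 /= in_itv/= => /andP[x0 x2]; exists x => //=.
  by rewrite in_itv/= x0 ltW.
exact: closed_expi_itv.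
Qed.

Lemma measurable_expi_preimage (A : set (borelC R)) : measurable A ->
  measurable (@expi R @^-1` A).
Proof. by move=> mA; rewrite -[X in measurable X]setTI; exact: measurable_expi. Qed.

Lemma arclengthE (A : set (borelC R)) :
  arclength R A = mu (@expi R @^-1` A `&` @cell R 0 0).
Proof. by rewrite cell00. Qed.

Lemma integral_arclength (A : set (borelC R)) (f : borelC R -> \bar R) :
  measurable A -> measurable_fun A f -> (forall z, A z -> 0 <= f z)%E ->
  (\int[arclength R]_(z in A) f z =
   \int[mu]_(x in @expi R @^-1` A `&` @cell R 0 0) f (expi x))%E.
Proof.
move=> mA mf f0.
have mpA := measurable_expi_preimage mA.
have mc : measurable (@cell R 0 0) by exact: measurable_cell.
have mfe : measurable_fun (@expi R @^-1` A) (f \o @expi R).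
  apply: (measurable_comp mA) => //; first by move=> _ [x Ax <-].
  by apply: measurable_funTS; exact: measurable_expi.
pose mI := measurable_itv `[0 : R, 2 * pi[.
have push (nu : {measure set (measurableTypeR R) -> \bar R}) :
    (\int[pushforward nu (@expi R)]_(z in A) f z =
     \int[nu]_(x in @expi R @^-1` A) (f \o @expi R) x)%E.
  apply: ge0_integral_pushforward; [exact: measurable_expi|exact: mA|exact: mf|].
  by move=> z /set_mem /f0.
pose m : {measure set (measurableTypeR R) -> \bar R} := mrestr mu mI.
refine (etrans (push m) _).
have mN : measurable (~` @cell R 0 0) by exact: measurableC.
have fe0 x : (@expi R @^-1` A) x -> (0 <= (f \o @expi R) x)%E by move=> Ax; exact: f0.
have mN0 : m (~` @cell R 0 0) = 0%E by rewrite /m/= /mrestr -cell00 setICl measure0.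
refine (etrans (@ge0_negligible_integral _ (measurableTypeR R) R m _ _ _ mN mpA mfe fe0 mN0) _).
rewrite setDE setCK.
apply: (@eq_measure_integral _ (measurableTypeR R) R) => B mB BA.
by rewrite /m/= /mrestr -cell00 setIidl// => x /BA[].
Qed.

End CircleParametrization.

(** * Every dyadic cell is saturated *)

Lemma measurable_lne_EFin (R : realType) : measurable_fun setT (fun r : R => lne r%:E).
Proof.
apply: (@measurable_fun_ifT _ _ _ _ (cst -oo%E) (fun r : R => (ln r)%:E) (fun r => r <= 0)).
- by apply: measurable_fun_ler => //; exact: measurable_cst.
- exact: measurable_cst.
- by apply/measurable_EFinP; exact: measurable_ln.
Qed.

Section Saturation.
Variables (R : realType) (h : R -> R) (w : borelC R -> R) (e : R).
Hypothesis hh : gauge_function h.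
Hypothesis w_ge0 : forall z, circle R z -> 0 <= w z.
Hypothesis w_L1 : (arclength R).-integrable (circle R) (EFin \o w).
Hypothesis e_gt0 : 0 < e.
Hypothesis logw : forall E : set (R[i])^o, carleson_set h E ->
  (0 < arclength R E)%E ->
  (\int[arclength R]_(z in E) lne (w z)%:E)%E = -oo%E.

Local Notation mu := (@lebesgue_measure R).
Local Notation arc := (arc_length R).

Definition circle_weight (x : R) : R := w (expi x).
Let W := circle_weight.
Let b := gauge_bound h e.
Local Notation sat := (saturated b (leaf W b)).
Local Notation cap := (limit_capacity b (leaf W b)).

Lemma circle_weight_ge0 x : 0 <= circle_weight x.
Proof. by apply: w_ge0; exact: circle_expi. Qed.

Let mcircle : measurable (circle R : set (borelC R)).
Proof. by apply: closed_measurableC; exact: closed_circle. Qed.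

Lemma measurable_circle_weight : measurable_fun (circle R : set (borelC R)) w.
Proof. by apply/measurable_EFinP; have /integrableP[] := w_L1. Qed.

Let preimage_circle : @expi R @^-1` (circle R) = setT.
Proof. by apply/seteqP; split => // x _; exact: circle_expi. Qed.

Lemma integral_circle_weight :
  (\int[arclength R]_(z in circle R) (w z)%:E
   = \int[mu]_(x in @cell R 0 0) (circle_weight x)%:E)%E.
Proof.
rewrite integral_arclength// ?preimage_circle ?setTI//.
by apply/measurable_EFinP; exact: measurable_circle_weight.
Qed.

Lemma measurable_circle_weightT : measurable_fun setT circle_weight.
Proof.
have mcomp : measurable_fun (@expi R @^-1` circle R) circle_weight.
  apply: (measurable_comp mcircle _ measurable_circle_weight).
    by move=> _ [x Ax <-].
  by apply: measurable_funTS; exact: measurable_expi.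
by rewrite preimage_circle in mcomp.
Qed.

Lemma circle_weight_integrable : mu.-integrable (@cell R 0 0) (EFin \o circle_weight).
Proof.
apply/integrableP; split.
  by apply: measurable_funTS; apply/measurable_EFinP; exact: measurable_circle_weightT.
have /integrableP[_] := w_L1.
have -> : (\int[arclength R]_(z in circle R) `|(EFin \o w) z|
    = \int[arclength R]_(z in circle R) (w z)%:E)%E.
  apply: eq_integral => z /set_mem zc; rewrite /= ger0_norm//.
  exact: w_ge0.
rewrite integral_circle_weight; congr (_ < _)%E.
by apply: eq_integral => x _; rewrite /= ger0_norm// circle_weight_ge0.
Qed.

Let W_ge0 := circle_weight_ge0.
Let W_int := circle_weight_integrable.
Let b_ge0 l : 0 <= b l. Proof. by rewrite (gauge_bound_ge0 hh)// ltW. Qed.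
Let b_nd l l' : (l <= l')%N -> b l <= b l'.
Proof. by apply: gauge_bound_nd => //; exact: ltW. Qed.
Let b_cvg : b l @[l --> \oo] --> +oo.
Proof. exact: gauge_bound_cvg. Qed.
Let b_gauge l : arc l * b l = e * h (arc l).
Proof.
have := arc_length_gt0 R l; rewrite /b /gauge_bound; set a := arc l => a0.
by field; rewrite gt_eqF.
Qed.

Section FromLevel.
Variable n0 : nat.

Let TL := trace_limit W b n0.

Let TL_ge0 x : (0 <= TL x)%E. Proof. exact: trace_limit_ge0. Qed.
Let mTL D : measurable_fun D TL. Proof. exact: measurable_trace_limit. Qed.

Let TL_int : (\int[mu]_(x in @cell R 0 0) TL x < +oo)%E.
Proof.
suff H d : forall l k, (l + d)%N = n0 -> (\int[mu]_(x in @cell R l k) TL x < +oo)%E.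
  by apply: (H n0); rewrite add0n.
elim: d => [|d IH] l k ld.
  rewrite addn0 in ld; rewrite ld.
  by rewrite (le_lt_trans (integral_trace_limit _ _ _ _ _ _))// ltry.
rewrite cell_split ge0_integral_setU//=.
- by rewrite lte_add_pinfty// IH// addSnnS.
- exact: measurable_cell.
- exact: measurable_cell.
- exact: mTL.
- by apply: cell_disj; rewrite neq_ltn ltnSn.
Qed.

(* The maximal saturated cells. *)
Definition stopped : set (nat * nat) := [set p | [/\ (n0 <= p.1)%N,
  (p.2 < 2 ^ p.1)%N, sat p.1 p.2 &
  forall l', (n0 <= l' < p.1)%N -> ~~ sat l' (p.2 %/ 2 ^ (p.1 - l'))]].

Definition open_cell (p : nat * nat) : set R :=
  `]arc p.1 * p.2%:R, arc p.1 * p.2.+1%:R[.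

Definition open_arc p : set (R[i])^o := @expi R @` open_cell p.

(** Only open arcs are removed: the set is closed, and adjacent stopped arcs stay separated by their
    common endpoint, so each is a component of the complement. *)
Definition stopped_complement : set (R[i])^o :=
  [set z | circle R z /\ forall p, stopped p -> ~ open_arc p z].

Let E := stopped_complement.

Lemma open_cell_sub p : open_cell p `<=` cell p.1 p.2.
Proof.
by move=> x; rewrite /open_cell /cell /= !in_itv/= => /andP[/ltW -> ->].
Qed.

Lemma cell_sub00 l k : (k < 2 ^ l)%N -> @cell R l k `<=` cell 0 0.
Proof.
move=> kl x kx; have x0 := cell_ge0 kx; apply/(cellP 0 0 x0).
rewrite -(cell_index_div 0 l x0) add0n (proj1 (cellP _ _ x0) kx).
by rewrite divn_small.
Qed.

Lemma stopped_first p (x : R) : stopped p -> cell p.1 p.2 x ->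
  first_saturated W b n0 p.1 x.
Proof.
move=> [n0p _ sp ns] px; have x0 := cell_ge0 px.
have ix := proj1 (cellP _ _ x0) px.
split; rewrite ?ix// => l' /andP[n0l' l'p].
have := ns l'; rewrite n0l' l'p => /(_ isT).
by rewrite -ix -{1}(subnKC (ltnW l'p)) cell_index_div.
Qed.

Lemma first_stopped l (x : R) : cell 0 0 x -> first_saturated W b n0 l x ->
  stopped (l, cell_index l x).
Proof.
move=> xc [n0l sl ns]; split => //=; first exact: cell_index_lt.
move=> l' /[dup] /andP[_ l'l] /ns.
by rewrite -(cell_index_div l' (l - l') (cell_ge0 xc)) subnKC ?(ltnW l'l).
Qed.

(** A point determines the first level at which its cell is saturated, and so the stopped cell
    containing it. *)
Lemma stopped_inj p q (x : R) : stopped p -> stopped q ->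
  cell p.1 p.2 x -> cell q.1 q.2 x -> p = q.
Proof.
move=> Dp Dq px qx; have x0 := cell_ge0 px.
have [np sp hp] := stopped_first Dp px; have [nq sq hq] := stopped_first Dq qx.
have e1 : p.1 = q.1.
  have [lt|lt|//] := ltngtP p.1 q.1.
    by have := hq p.1; rewrite np lt sp => /(_ isT).
  by have := hp q.1; rewrite nq lt sq => /(_ isT).
have ip := proj1 (cellP _ _ x0) px; have iq := proj1 (cellP _ _ x0) qx.
have e2 : p.2 = q.2 by rewrite -ip -iq e1.
rewrite (surjective_pairing p) (surjective_pairing q) e1 e2.
exact: erefl.
Qed.

Lemma open_arcP p (x : R) : stopped p -> cell 0 0 x -> open_arc p (expi x) <-> open_cell p x.
Proof.
move=> [_ p2 _ _] xc; split=> [[y py yx]|px]; last by exists x.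
have yc : cell 0 0 y by apply: (cell_sub00 p2); exact: open_cell_sub.
by rewrite -(expi_inj yc xc yx).
Qed.

Let a0 p : 0 <= arc p.1 * p.2%:R :> R.
Proof. by rewrite mulr_ge0// ltW// arc_length_gt0. Qed.

Let ab p : arc p.1 * p.2%:R < arc p.1 * p.2.+1%:R :> R.
Proof. by rewrite ltr_pM2l ?arc_length_gt0// ltr_nat. Qed.

Let b2pi p : stopped p -> arc p.1 * p.2.+1%:R <= 2 * pi :> R.
Proof.
move=> [_ p2 _ _]; rewrite /arc_length mulrAC ler_pdivrMr ?pow2_gt0//.
by rewrite ler_wpM2l ?ler_nat// mulr_ge0 ?pi_ge0.
Qed.

Let cell00E (x : R) : cell 0 0 x <-> 0 <= x < 2 * pi.
Proof. by rewrite cell00 /= in_itv/=. Qed.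

Let expiD2pi (x : R) : expi (x + 2 * pi) = expi x.
Proof. by rewrite /expi mulr_natl cosD2pi sinD2pi. Qed.

(* Inside the circle an open arc is the complement of a closed one, so it is
   relatively open. *)
Lemma open_arc_compl p z : stopped p -> circle R z ->
  open_arc p z <-> ~ (@expi R @` `[arc p.1 * p.2.+1%:R, arc p.1 * p.2%:R + 2 * pi]) z.
Proof.
move=> Dp /expi_surj[x xc ->]; have /cell00E/andP[x0 x2] := xc.
have A0 := a0 p; have AB := ab p; have B2 := b2pi Dp.
split=> [/(open_arcP Dp xc)|nz].
  rewrite /open_cell /= in_itv/= => /andP[ax xb] [y].
  rewrite /= in_itv/= => /andP[y1 y2] yx.
  have [y2pi|y2pi] := ltP y (2 * pi).
    have yc : cell 0 0 y by apply/cell00E; apply/andP; split; lra.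
    by have := expi_inj yc xc yx; lra.
  have yc : cell 0 0 (y - 2 * pi) by apply/cell00E; apply/andP; split; lra.
  have yx' : expi (y - 2 * pi) = expi x by rewrite -expiD2pi subrK.
  by have := expi_inj yc xc yx'; lra.
apply/(open_arcP Dp xc); rewrite /open_cell /= in_itv/=; apply/andP; split.
  rewrite ltNge; apply/negP => xa; apply: nz; exists (x + 2 * pi) => //.
  by rewrite /= in_itv/=; apply/andP; split; lra.
rewrite ltNge; apply/negP => xb; apply: nz; exists x => //.
by rewrite /= in_itv/=; apply/andP; split; lra.
Qed.

Lemma closed_stopped_complement : closed E.
Proof.
have -> : E = circle R `&` \bigcap_(p in stopped)
    (@expi R @` `[arc p.1 * p.2.+1%:R, arc p.1 * p.2%:R + 2 * pi]).
  apply/seteqP; split=> z [zc H]; split=> // p Dp.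
    by apply: contrapT => /(open_arc_compl Dp zc); exact: H.
  by move=> /(open_arc_compl Dp zc); apply; exact: H.
apply: closedI; first exact: closed_circle.
by apply: closed_bigI => p _; exact: closed_expi_itv.
Qed.

Let circleD z : (circle R `\` E) z -> exists2 p, stopped p & open_arc p z.
Proof.
move=> [zc nE]; apply: contrapT => H; apply: nE; split=> // p Dp pz.
by apply: H; exists p.
Qed.

Lemma open_arc_sub p : stopped p -> open_arc p `<=` circle R `\` E.
Proof.
move=> Dp z pz; split; last by move=> [_ /(_ p Dp)].
by case: pz => x _ <-; exact: circle_expi.
Qed.

(* An endpoint of a maximal saturated cell cannot be interior to another one. *)
Lemma stopped_endpoint p q x : stopped p -> stopped q -> open_cell q x ->
  x = arc p.1 * p.2%:R \/ x = arc p.1 * p.2.+1%:R -> False.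
Proof.
move=> Dp Dq qx [xa|xb]; have AB := ab p.
  have px : cell p.1 p.2 x by rewrite /cell /= in_itv/= xa lexx AB.
  have pq := stopped_inj Dp Dq px (open_cell_sub qx).
  by move: qx; rewrite -pq /open_cell /= in_itv/= xa ltxx.
move: (qx); rewrite /open_cell /= in_itv/= => /andP[q1 q2].
pose m := Num.max (arc p.1 * p.2%:R) (arc q.1 * q.2%:R).
have mx : m < x by rewrite /m gt_max q1 xb AB.
have ma : arc p.1 * p.2%:R <= m by rewrite le_max lexx.
have mq : arc q.1 * q.2%:R <= m by rewrite le_max lexx orbT.
have pm : cell p.1 p.2 m by rewrite /cell /= in_itv/= ma -xb.
have qm : cell q.1 q.2 m by rewrite /cell /= in_itv/= mq (lt_trans mx).
have pq := stopped_inj Dp Dq pm qm.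
by move: q2; rewrite -pq -xb ltxx.
Qed.

(** The arc is connected, relatively open (its complement in the circle is a closed arc) and
    relatively closed (its closure adds only endpoints, which lie in no stopped open arc), so it is
    the whole component. *)
Lemma component_open_arc p z : stopped p -> open_arc p z ->
  connected_component (circle R `\` E) z = open_arc p.
Proof.
move=> Dp pz; set C := connected_component _ _.
have Csub : C `<=` circle R `\` E by exact: connected_component_sub.
have arcC : open_arc p `<=` C.
  by apply: connected_component_max => //; [exact: open_arc_sub | exact: connected_expi_itv].
apply/seteqP; split=> //.
have : C `&` open_arc p = C.
  apply: (component_connected (A := circle R `\` E) (x := z)).
  - by exists z; split => //; exact: arcC.
  - exists (~` (@expi R @` `[arc p.1 * p.2.+1%:R, arc p.1 * p.2%:R + 2 * pi])).
      by apply: closed_openC; exact: closed_expi_itv.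
    apply/seteqP; split=> y [Cy py]; split=> //; have [yc _] := Csub _ Cy.
      exact: (proj1 (open_arc_compl Dp yc) py).
    exact: (proj2 (open_arc_compl Dp yc) py).
  - exists (@expi R @` `[arc p.1 * p.2%:R, arc p.1 * p.2.+1%:R]).
      exact: closed_expi_itv.
    apply/seteqP; split=> y [Cy].
      move=> [x px xy]; split => //; exists x => //.
      by move: px; rewrite /open_cell /= !in_itv/= => /andP[/ltW -> /ltW ->].
    move=> [x + xy]; rewrite /= in_itv/= => /andP[ax xb]; split=> //.
    have [q Dq [x' qx' x'y]] := circleD (Csub _ Cy).
    have x'c : cell 0 0 x'.
      by have [_ q2 _ _] := Dq; apply: (cell_sub00 q2); exact: open_cell_sub.
    have A0 := a0 p; have B2 := b2pi Dp.
    have x'0 : 0 < x'.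
      move: qx'; rewrite /open_cell /= in_itv/= => /andP[+ _].
      by apply: le_lt_trans; exact: (a0 q).
    have xx' : x = x'.
      have e2 : expi x = expi x' by rewrite xy x'y.
      have [x2|x2] := ltP x (2 * pi).
        by apply: expi_inj => //; apply/cell00E; rewrite x2 (le_trans A0).
      (* The right end of the last cell wraps round to the angle 0, which lies in no open cell. *)
      have x2pi : x = 0 + 2 * pi by lra.
      rewrite x2pi expiD2pi in e2.
      have c0 : cell 0 0 (0 : R) by apply/cell00E; rewrite lexx mulr_gt0 ?pi_gt0.
      by have := expi_inj c0 x'c e2; lra.
    exists x => //; rewrite /open_cell /= in_itv/= !lt_neqAle ax xb !andbT.
    apply/andP; split; apply/eqP => ee.
      by apply: (stopped_endpoint Dp Dq qx'); left; rewrite -xx' ee.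
    by apply: (stopped_endpoint Dp Dq qx'); right; rewrite -xx' ee.
by move=> <- y [].
Qed.

Lemma open_cell_nonempty p : open_cell p !=set0.
Proof.
have AB := ab p; exists ((arc p.1 * p.2%:R + arc p.1 * p.2.+1%:R) / 2).
by rewrite /open_cell /= in_itv/=; apply/andP; split; lra.
Qed.

Lemma open_arc_inj : set_inj stopped open_arc.
Proof.
move=> p q /set_mem Dp /set_mem Dq pq; have [x px] := open_cell_nonempty p.
have xc : cell 0 0 x.
  by have [_ p2 _ _] := Dp; apply: (cell_sub00 p2); exact: open_cell_sub.
have := proj2 (open_arcP Dp xc) px; rewrite pq => /(open_arcP Dq xc) qx.
exact: (stopped_inj Dp Dq (open_cell_sub px) (open_cell_sub qx)).
Qed.

Lemma arclength_open_arc p : stopped p -> arclength R (open_arc p) = (arc p.1)%:E.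
Proof.
move=> Dp; rewrite arclengthE.
have -> : @expi R @^-1` open_arc p `&` cell 0 0 = open_cell p.
  apply/seteqP; split=> x; first by move=> [px xc]; exact/(open_arcP Dp xc).
  move=> px; have xc : cell 0 0 x.
    by have [_ p2 _ _] := Dp; apply: (cell_sub00 p2); exact: open_cell_sub.
  by split => //; exact/(open_arcP Dp xc).
rewrite /open_cell lebesgue_measure_itv/= lte_fin ab -EFinD.
by rewrite -natr1 mulrDr mulr1 addrAC subrr add0r.
Qed.

Lemma complementary_arcs_stopped : complementary_arcs E = open_arc @` stopped.
Proof.
apply/seteqP; split=> [_ [z zE <-]|_ [p Dp <-]].
  by have [p Dp pz] := circleD zE; exists p => //; rewrite (component_open_arc Dp pz).
have [x px] := open_cell_nonempty p.
have pz : open_arc p (expi x) by exists x.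
by exists (expi x); [exact: (open_arc_sub Dp) | exact: component_open_arc].
Qed.

Lemma integral_stopped p : stopped p ->
  (\int[mu]_(x in cell p.1 p.2) TL x = (e * h (arc p.1))%:E)%E.
Proof.
move=> Dp; rewrite (eq_integral (fun=> (b p.1)%:E)).
  rewrite integral_cst; last exact: measurable_cell.
  by rewrite [X in (_ * X)%E]mu_cell -EFinM mulrC b_gauge.
move=> x /set_mem px; apply: trace_limit_saturated; first exact: cell_ge0 px.
exact: stopped_first.
Qed.

(** On a stopped cell the trace limit is the constant [b l], with integral [e * h (arc l)]. The
    Carleson sum is thus 1/e times the integral of the trace limit over disjoint cells, which is
    finite. *)
Lemma carleson_stopped_complement : carleson_set h E.
Proof.
split; [exact: closed_stopped_complement|by move=> z []|].
rewrite complementary_arcs_stopped esum_image; last exact: open_arc_inj.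
set J := (\int[mu]_(x in cell 0 0) TL x)%E.
apply: (@le_lt_trans _ _ (e^-1%:E * J)%E); last first.
  by rewrite lte_mul_pinfty// lee_fin invr_ge0 ltW.
apply: ub_ereal_sup => _ [A [finA AD] <-]; rewrite fsbig_finite//=.
have AS p : p \in fset_set A -> stopped p.
  by rewrite in_fset_set// => /set_mem /AD.
rewrite (eq_big_seq (fun p => e^-1%:E * \int[mu]_(x in cell p.1 p.2) TL x)%E); last first.
  move=> p /AS Dp; rewrite arclength_open_arc//= integral_stopped// -EFinM.
  by rewrite mulrA mulVf ?mul1r// gt_eqF.
rewrite -ge0_sume_distrr; last by move=> p _; exact: integral_ge0.
rewrite lee_pmul2l ?lte_fin ?invr_gt0//.
have tr : trivIset [set` fset_set A] (fun p : nat * nat => @cell R p.1 p.2).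
  by move=> p q /= /AS Dp /AS Dq [x [px qx]]; exact: (stopped_inj Dp Dq px qx).
rewrite -ge0_integral_bigsetU//=.
- apply: ge0_subset_integral => //.
  + by apply: bigsetU_measurable => p _; exact: measurable_cell.
  + exact: measurable_cell.
  + exact: mTL.
  + rewrite -bigcup_seq => x [p /= /AS [_ p2 _ _]].
    exact: cell_sub00.
- by move=> p; exact: measurable_cell.
- exact: fset_uniq.
- exact: mTL.
Qed.

Let E' := @expi R @^-1` E `&` @cell R 0 0.

Let mEC : measurable (E : set (borelC R)).
Proof. by apply: closed_measurableC; exact: closed_stopped_complement. Qed.

Let mE' : measurable E'.
Proof.
by apply: measurableI; [exact: measurable_expi_preimage | exact: measurable_cell].
Qed.

(** All dyadic endpoints. The left endpoint of a stopped cell remains in [E] although its cell is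
    saturated; such points form a countable, hence null, set. *)
Let grid : set R := (fun p : nat * nat => arc p.1 * p.2%:R) @` setT.

Let never_stopped x : E' x -> ~ grid x -> never_saturated W b n0 x.
Proof.
move=> [[_ nE] xc] ng; have [[l fl]|//] := first_saturated_or_never W b n0 x.
have Dp := first_stopped xc fl; case: (nE _ Dp); apply/(open_arcP Dp xc).
have : cell l (cell_index l x) x by apply/(cellP _ _ (cell_ge0 xc)).
rewrite /open_cell /cell /= !in_itv/= => /andP[h1 h2].
rewrite h2 andbT lt_neqAle h1 andbT; apply/eqP => ex; apply: ng.
by exists (l, cell_index l x).
Qed.

Let f (z : borelC R) := lne (w z)%:E.

Let mf : measurable_fun (E : set (borelC R)) f.
Proof.
apply: (measurableT_comp (@measurable_lne_EFin R)).
by apply: (measurable_funS mcircle _ measurable_circle_weight) => z [].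
Qed.

(** Almost everywhere on [E] no cell is saturated and the trace limit is the negative part of log w,
    so its integral is at most that of the trace limit. *)
Let integral_never : (\int[mu]_(x in E') (f^\- (expi x)) < +oo)%E.
Proof.
apply: (@le_lt_trans _ _ (\int[mu]_(x in E') TL x)%E); last first.
  apply: (le_lt_trans _ TL_int); apply: ge0_subset_integral => //.
  - exact: measurable_cell.
  - exact: mTL.
  - by move=> x [].
rewrite le_eqVlt; apply/orP; left; apply/eqP.
apply: ge0_ae_eq_integral => //.
- have mg : measurable_fun setT (fun x => lne (W x)%:E).
    exact: (measurableT_comp (@measurable_lne_EFin R) measurable_circle_weightT).
  have mgn : measurable_fun setT (fun x => lne (W x)%:E)^\-%E.
    exact: measurable_funeneg.
  rewrite (_ : (fun x => _) = (fun x => lne (W x)%:E)^\-%E).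
    exact: (measurable_funS measurableT (@subsetT _ _) mgn).
  by apply: funext => x; rewrite !funenegE.
- exact: mTL.
- have N1 : mu.-negligible grid.
    have cg : countable grid.
      by apply: (sub_countable (card_image_le _ _)); exact: countableP.
    exists grid; split => //; first exact: countable_measurable.
    exact: countable_lebesgue_measure0.
  have N2 := trace_limit_never W_ge0 W_int b_cvg n0.
  have := negligibleU N1 N2; apply: negligibleS => x /= nP.
  apply: contrapT => nU; apply: nP => Ex.
  have [ng nn] : ~ grid x /\ (cell 0 0 x -> never_saturated W b n0 x ->
      TL x = maxe (- lne (W x)%:E)%E 0%E).
    by split; [move=> gx; apply: nU; left | apply: contrapT => k; apply: nU; right].
  by rewrite funenegE nn//; [case: Ex | exact: never_stopped].
Qed.

(** With the negative part of log w integrable over the Carleson set [E], the integral of log w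
    cannot be minus infinity; the hypothesis then forbids positive measure. *)
Lemma stopped_complement_null : mu E' = 0%E.
Proof.
apply/eqP; rewrite eq_le measure_ge0 andbT leNgt; apply/negP => pos.
have := logw carleson_stopped_complement; rewrite arclengthE => /(_ pos).
rewrite integralE (integral_arclength mEC (measurable_funeneg mf)) => [H|z _]; last first.
  exact: funeneg_ge0.
have In : (0 <= \int[mu]_(x in E') (f^\- (expi x)))%E by exact: integral_ge0.
have aux (x y : \bar R) : (0 <= x -> y < +oo -> 0 <= y -> x - y <> -oo)%E.
  by case: x => [r| |]; case: y => [s| |].
by apply: (aux _ _ _ integral_never In H); exact: integral_ge0.
Qed.

(** Almost every point of the cell lies in a stopped cell of level l >= n0, where the trace limit is
    [b l >= b n0]. Integrating, [arc n0 * b n0] is at most [arc n0] times the limit capacity. *)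
Lemma all_saturated k : (k < 2 ^ n0)%N -> sat n0 k.
Proof.
move=> kn; have leW : forall l i, leaf W b l i <= b l by apply: leaf_le => //; exact: W_ge0.
have avgW : forall l i, leaf W b l i <= (leaf W b l.+1 i.*2 + leaf W b l.+1 i.*2.+1) / 2.
  by apply: leaf_avg.
rewrite /saturated eq_le (limit_capacity_le leW avgW)/=.
have mc : measurable (@cell R n0 k) by exact: measurable_cell.
rewrite -(ler_pM2l (arc_length_gt0 R n0)) -lee_fin.
apply: le_trans (integral_trace_limit W_ge0 W_int b_ge0 b_nd n0 k).
have -> : (arc n0 * b n0)%:E = (\int[mu]_(x in cell n0 k) (b n0)%:E)%E.
  by rewrite integral_cst// [X in (_ * X)%E]mu_cell -EFinM mulrC.
have b0E x : (@cell R n0 k) x -> (0 <= (b n0)%:E)%E by rewrite lee_fin.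
rewrite (@ge0_negligible_integral _ (measurableTypeR R) R mu _ _ (cst (b n0)%:E)
  mE' mc (@measurable_cst _ _ _ _ _ _) b0E stopped_complement_null).
have mD : measurable (cell n0 k `\` E') by exact: measurableD.
apply: (@le_trans _ _ (\int[mu]_(x in cell n0 k `\` E') TL x)%E); last first.
  apply: ge0_subset_integral => //; exact: mTL.
apply: (@ge0_le_integral _ (measurableTypeR R) R mu _ mD (cst (b n0)%:E) TL).
- by move=> x _; rewrite lee_fin.
- exact: measurable_cst.
- exact: mTL.
move=> x [kx nE]; have xc := cell_sub00 kn kx.
have [p Dp pz] : exists2 p, stopped p & open_arc p (expi x).
  apply: circleD; split; first exact: circle_expi.
  by move=> Ez; apply: nE.
have px := open_cell_sub (proj1 (open_arcP Dp xc) pz).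
have fp := stopped_first Dp px; have [n0p _ _] := fp.
rewrite /TL (trace_limit_saturated (cell_ge0 kx) fp) lee_fin.
exact: b_nd.
Qed.

End FromLevel.
End Saturation.

(** * Block sums of the flow, and one depth for all cells of a level *)

Section FlowSums.
Variables (R : realType) (b : nat -> R) (v : nat -> nat -> R).
Hypothesis v_ge0 : forall l k, 0 <= v l k.
Hypothesis v_le : forall l k, v l k <= b l.
Hypothesis v_avg : forall l k, v l k <= (v l.+1 k.*2 + v l.+1 k.*2.+1) / 2.
Variables (n0 D : nat) (M : R).
Hypothesis M_ge0 : 0 <= M.
Hypothesis M_le : forall k, (k < 2 ^ n0)%N -> M <= capacity b v D n0 k.

Lemma flow_block_sum d i k : (k < 2 ^ (n0 + i))%N ->
  \sum_(j < 2 ^ d) flow b v n0 D M (i + d) (k * 2 ^ d + j)%N =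
  2 ^+ d * flow b v n0 D M i k.
Proof.
elim: d i k => [|d IH] i k kn.
  by rewrite expn0 big_ord1 muln1 !addn0 expr0 mul1r.
have k2 c : (c < 2)%N -> (k.*2 + c < 2 ^ (n0 + i.+1))%N.
  by move=> c2; rewrite addnS expnS mul2n -!muln2; lia.
have k20 := k2 0%N isT; have k21 := k2 1%N isT.
rewrite addn0 in k20; rewrite addn1 in k21.
rewrite addnS -addSn sum_dyadic_split !IH// -mulrDr.
by rewrite flow_avg// exprS; ring.
Qed.

Lemma capacity_uniform : (forall k, (k < 2 ^ n0)%N -> M < limit_capacity b v n0 k) ->
  exists D, forall k, (k < 2 ^ n0)%N -> M <= capacity b v D n0 k.
Proof.
move=> H; suff : forall K, (K <= 2 ^ n0)%N ->
    exists D, forall k, (k < K)%N -> M <= capacity b v D n0 k.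
  by apply.
elim=> [_|K IH Kn]; first by exists 0%N.
have [D1 HD1] := IH (ltnW Kn).
have /cvgrPdist_lt := capacity_cvg v_le v_avg (l := n0) (k := K).
have pos : 0 < limit_capacity b v n0 K - M by rewrite subr_gt0 H.
move=> /(_ _ pos) [D2 _ /(_ D2 (leqnn _))] /= hD2.
have mono d1 d2 k : (d1 <= d2)%N -> capacity b v d1 n0 k <= capacity b v d2 n0 k.
  by move=> d12; exact: (capacity_nd v_le v_avg n0 k d12).
exists (maxn D1 D2) => k; rewrite ltnS leq_eqVlt => /orP[/eqP ->|kK].
  apply: le_trans (mono _ _ _ (leq_maxr D1 D2)).
  by move: hD2; rewrite ltr_norml => /andP[_]; lra.
apply: le_trans (mono _ _ _ (leq_maxl D1 D2)).
exact: HD1.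
Qed.

End FlowSums.

(** * Measurability of powers of the modulus of a polynomial *)

Section MeasurableModulus.
Variable R : realType.

Let measurable_part (f : (R[i])^o -> R) :
  (forall z y, `|f z - f y| <= normc ((z : R[i]) - y)) ->
  measurable_fun setT (f : borelC R -> R).
Proof.
move=> fl; have cf : continuous f.
  move=> z U [c /= c0 cU]; exists c%:C; first by rewrite /= ltcR.
  move=> y yz; have zy : normc ((z : R[i]) - y) < c by rewrite -ltcR.
  by apply: cU; exact: le_lt_trans zy.
apply: (measurability _ (RGenOpens.measurableE R)) => _ [_ [x [y ->]] <-].
rewrite setTI; apply: open_measurableC; move/continuousP : cf; apply.
exact: itv_open.
Qed.

Let mC (F : borelC R -> R[i]) :=
  measurable_fun setT (fun z => complex.Re (F z)) /\
  measurable_fun setT (fun z => complex.Im (F z)).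

Let mC_horner (p : {poly R[i]}) : mC (fun z : borelC R => p.[z]).
Proof.
have Im_le (z : R[i]) : `|complex.Im z| <= normc z.
  rewrite -(ler_pXn2r (ltn0Sn 1)) ?nnegrE ?normc_ge0//.
  by rewrite normc_sqr real_normK ?num_real// lerDr sqr_ge0.
have mid : mC (fun z => z).
  split; apply: measurable_part => z y.
    by have := Re_le_normc ((z : R[i]) - y); case: z y => ? ? [].
  by have := Im_le ((z : R[i]) - y); case: z y => ? ? [].
elim/poly_ind: p => [|p c [IHr IHi]].
  rewrite (_ : (fun z => _) = fun=> 0); last by apply: funext => z; rewrite horner0.
  by split; exact: measurable_cst.
have [mr mi] := mid.
have ReE (a y q : R[i]) : complex.Re (a * y + q) =
    complex.Re a * complex.Re y - complex.Im a * complex.Im y + complex.Re q.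
  by case: a y q => ? ? [? ?] [? ?].
have ImE (a y q : R[i]) : complex.Im (a * y + q) =
    complex.Re a * complex.Im y + complex.Im a * complex.Re y + complex.Im q.
  by case: a y q => ? ? [? ?] [? ?].
split.
  rewrite (_ : (fun z => _) = fun z : borelC R => complex.Re p.[z] * complex.Re z
      - complex.Im p.[z] * complex.Im z + complex.Re c); last first.
    by apply: funext => z; rewrite hornerMXaddC; exact: ReE.
  apply: measurable_funD; last exact: measurable_cst.
  by apply: measurable_funB; exact: measurable_funM.
rewrite (_ : (fun z => _) = fun z : borelC R => complex.Re p.[z] * complex.Im z
    + complex.Im p.[z] * complex.Re z + complex.Im c); last first.
  by apply: funext => z; rewrite hornerMXaddC; exact: ImE.
apply: measurable_funD; last exact: measurable_cst.
by apply: measurable_funD; exact: measurable_funM.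
Qed.

Lemma measurable_normc_horner (p : {poly R[i]}) (t : R) :
  measurable_fun setT (fun z : borelC R => normc p.[z] `^ t).
Proof.
have [mr mi] := mC_horner p.
rewrite (_ : (fun z => _) = fun z : borelC R =>
    (complex.Re p.[z] ^+ 2 + complex.Im p.[z] ^+ 2) `^ (2^-1 * t)); last first.
  apply: funext => z; rewrite powRrM -normc_sqr -powR_mulrn ?normc_ge0//.
  by rewrite -(powRrM _ 2%:R) divff ?powRr1 ?normc_ge0.
have mp : measurable_fun setT (fun y : R => y `^ (2^-1 * t)) by exact: measurable_powR.
have ms : measurable_fun setT (fun z : borelC R =>
    complex.Re p.[z] ^+ 2 + complex.Im p.[z] ^+ 2).
  by apply: measurable_funD; exact: measurable_funX.
first [exact: (measurableT_comp mp ms) | exact: (measurable_comp measurableT (@subsetT _ _) mp ms)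
  | by apply: measurableT_comp | refine (@measurableT_comp _ _ _ _ _ _ _ _ mp _ _ ms)].
Qed.

End MeasurableModulus.

(** * One polynomial of the sequence *)

Section Assembly.
Variables (R : realType) (h : R -> R) (w : borelC R -> R) (t eps : R).
Hypothesis hh : gauge_function h.
Hypothesis w_ge0 : forall z, circle R z -> 0 <= w z.
Hypothesis w_L1 : (arclength R).-integrable (circle R) (EFin \o w).
Hypothesis t_gt0 : 0 < t.
Hypothesis eps_gt0 : 0 < eps.
Hypothesis logw : forall E : set (R[i])^o, carleson_set h E ->
  (0 < arclength R E)%E ->
  (\int[arclength R]_(z in E) lne (w z)%:E)%E = -oo%E.

Local Notation mu := (@lebesgue_measure R).
Local Notation arc := (arc_length R).

(** 36 is the constant of [flow_polynomial]; the factor t is there because the flow is divided by t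
    before exponentiation. *)
Let e := t * eps / 36.
Let e_gt0 : 0 < e. Proof. by rewrite divr_gt0 ?mulr_gt0. Qed.
Let W := circle_weight w.
Let W_ge0 : forall x, 0 <= W x := circle_weight_ge0 w_ge0.
Let W_int : mu.-integrable (@cell R 0 0) (EFin \o W) := circle_weight_integrable w_ge0 w_L1.
Let mW : measurable_fun setT W := measurable_circle_weightT w_L1.
Let b := gauge_bound h e.
Let b_ge0 l : 0 <= b l. Proof. by rewrite (gauge_bound_ge0 hh)// ltW. Qed.
Let b_nd l l' : (l <= l')%N -> b l <= b l'.
Proof. by apply: gauge_bound_nd => //; exact: ltW. Qed.
Let v := leaf W b.
Let v_ge0 l k : 0 <= v l k. Proof. exact: leaf_ge0. Qed.
Let v_le l k : v l k <= b l. Proof. by apply: leaf_le. Qed.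
Let v_avg l k : v l k <= (v l.+1 k.*2 + v l.+1 k.*2.+1) / 2.
Proof. by apply: leaf_avg. Qed.

Lemma integral_cells_le (N : nat) (g1 g2 : R -> \bar R) :
  measurable_fun setT g1 -> measurable_fun setT g2 ->
  (forall x, 0 <= g1 x)%E -> (forall x, 0 <= g2 x)%E ->
  (forall k, (k < 2 ^ N)%N ->
    \int[mu]_(x in @cell R N k) g1 x <= \int[mu]_(x in @cell R N k) g2 x)%E ->
  (\int[mu]_(x in @cell R 0 0) g1 x <= \int[mu]_(x in @cell R 0 0) g2 x)%E.
Proof.
move=> m1 m2 p1 p2 H; suff K d : forall l k, (l + d)%N = N -> (k < 2 ^ l)%N ->
    (\int[mu]_(x in @cell R l k) g1 x <= \int[mu]_(x in @cell R l k) g2 x)%E.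
  by apply: (K N).
elim: d => [|d IH] l k ld kl; first by move: ld kl; rewrite addn0 => ->; exact: H.
have mc i : measurable (@cell R l.+1 i) by exact: measurable_cell.
have dj : [disjoint @cell R l.+1 k.*2 & @cell R l.+1 k.*2.+1].
  by apply: cell_disj; rewrite neq_ltn ltnSn.
have sp g : measurable_fun setT g -> (forall x, 0 <= g x)%E ->
    (\int[mu]_(x in @cell R l k) g x =
     \int[mu]_(x in @cell R l.+1 k.*2) g x + \int[mu]_(x in @cell R l.+1 k.*2.+1) g x)%E.
  move=> mg pg; rewrite cell_split.
  apply: (@ge0_integral_setU _ (measurableTypeR R) R mu _ _ (mc _) (mc _)) => //.
  exact: (measurable_funS measurableT (@subsetT _ _) mg).
rewrite (sp g1)// (sp g2)// leeD// IH ?addSnnS// expnS mul2n -!muln2; lia.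
Qed.

Definition far_from_grid (N : nat) (d x : R) : bool :=
  arc N * (cell_index N x)%:R + d <= x <= arc N * (cell_index N x).+1%:R - d.

Lemma measurable_far_from_grid N d : measurable_fun setT (far_from_grid N d).
Proof.
apply: measurable_and; apply: measurable_fun_ler => //.
- exact: (@measurable_step R (fun k => arc N * k%:R + d) N setT).
- exact: (@measurable_step R (fun k => arc N * k.+1%:R - d) N setT).
Qed.

(** The part of the weight near endpoints of cells, where only the crude bound on the modulus of the
    polynomial is available. *)
Definition near_weight (N : nat) (d x : R) : R :=
  if far_from_grid N d x then 0 else W x.

Lemma measurable_near_weight N d : measurable_fun setT (near_weight N d).
Proof.
apply: measurable_fun_ifT => //; first exact: measurable_far_from_grid.
Qed.

(** Off the countable grid, a point is eventually farther than 1/(n+1) from the endpoints of its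
    cell, so dominated convergence applies with dominating function [W]. *)
Lemma near_weight_small N (c : R) : 0 < c ->
  exists2 d, 0 < d <= pi &
    (\int[mu]_(x in @cell R 0 0) (near_weight N d x)%:E <= c%:E)%E.
Proof.
move=> c0.
pose g n (x : R) := (near_weight N n.+1%:R^-1 x)%:E.
have mc : measurable (@cell R 0 0) by exact: measurable_cell.
pose grid : set R := (fun k : nat => arc N * k%:R) @` setT.
have cg : countable grid.
  by apply: (sub_countable (card_image_le _ _)); exact: countableP.
have mgrid : measurable grid by exact: countable_measurable.
have g_ge0 n x : (0 <= g n x)%E.
  by rewrite /g /near_weight lee_fin; case: ifP.
have mg n D : measurable_fun D (g n).
  apply: (measurable_funS measurableT (@subsetT _ _)).
  by apply/measurable_EFinP; exact: measurable_near_weight.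
pose D := @cell R 0 0 `\` grid.
have mD : measurable D by exact: measurableD.
have cv : (\int[mu]_(x in D) g n x)%E @[n --> \oo] -->
    (\int[mu]_(x in D) (cst 0%E) x)%E.
  apply: (@dominated_cvg _ (measurableTypeR R) R mu D mD g (cst 0%E) (EFin \o W)).
  - by move=> n; exact: mg.
  - move=> x [xc ng]; apply: cvg_near_cst.
    have x0 := cell_ge0 xc.
    have : cell N (cell_index N x) x by apply/(cellP _ _ x0).
    rewrite /cell /= in_itv/= => /andP[h1 h2].
    have h1' : arc N * (cell_index N x)%:R < x.
      rewrite lt_neqAle h1 andbT; apply/eqP => ex; apply: ng.
      by exists (cell_index N x).
    pose s := Num.min (x - arc N * (cell_index N x)%:R)
                      (arc N * (cell_index N x).+1%:R - x).
    have s0 : 0 < s by rewrite lt_min !subr_gt0 h1'.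
    exists (Num.truncn s^-1) => // n /= ns.
    have ns' : n.+1%:R^-1 <= s.
      rewrite -[leRHS]invrK lef_pV2 ?posrE ?invr_gt0 ?ltr0n//.
      by rewrite ltW// -truncn_le_nat.
    have sl : s <= x - arc N * (cell_index N x)%:R by rewrite ge_min lexx.
    have sr : s <= arc N * (cell_index N x).+1%:R - x by rewrite ge_min lexx orbT.
    rewrite /g /near_weight /far_from_grid ifT//; apply/andP; split.
      by rewrite -lerBrDl (le_trans ns').
    by rewrite lerBrDr -lerBrDl (le_trans ns').
  - by [].
  - by apply: (@integrableS _ (measurableTypeR R) R mu (@cell R 0 0) D _ mc mD _ W_int) => x [].
  - move=> n x _; rewrite gee0_abs// /g /near_weight lee_fin.
    by case: ifP.
rewrite integral0 in cv.
have [nf cvf] := (fine_cvgP _ _).1 cv.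
have /cvgrPdist_lt /(_ _ c0) near2 := cvf.
near \oo => n.
exists n.+1%:R^-1.
  rewrite invr_gt0 ltr0n/= (@le_trans _ _ 1)// ?invf_le1 ?ltr0n ?ler1n//.
  by rewrite (le_trans _ (@pi_ge2 R))// ler1n.
have fn : (\int[mu]_(x in D) g n x)%E \is a fin_num by near: n.
rewrite (@ge0_negligible_integral _ (measurableTypeR R) R mu _ _ (g n) mgrid mc
  (mg n _) (fun x _ => g_ge0 n x) (countable_lebesgue_measure0 cg)).
rewrite -/D -[leLHS]fineK// lee_fin ltW//.
have : `|0 - fine (\int[mu]_(x in D) g n x)%E| < c by near: n.
by rewrite sub0r normrN; apply: le_lt_trans; exact: ler_norm.
Unshelve. all: by end_near. Qed.

Lemma flow_capacity (m : R) n0 : 0 <= m -> m < b n0 -> exists D,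
  forall k, (k < 2 ^ n0)%N -> m <= capacity b v D n0 k.
Proof.
move=> m0 mb; apply: capacity_uniform => // k kn.
by have /eqP -> := all_saturated hh w_ge0 w_L1 e_gt0 logw kn.
Qed.

Let b_scale l : b l = t * gauge_bound h (eps / 36) l.
Proof. by rewrite /b /gauge_bound /e; ring. Qed.

Let Wmass := (\int[mu]_(x in @cell R 0 0) (1 + W x)%:E)%E.

Let mW1 : measurable_fun setT (fun x => 1 + W x).
Proof. by apply: measurable_funD; [exact: measurable_cst | exact: mW]. Qed.

Let Wmass_fin : Wmass \is a fin_num.
Proof.
have mc : measurable (@cell R 0 0) by exact: measurable_cell.
have E1 : Wmass = (\int[mu]_(x in @cell R 0 0) (1%:E + (W x)%:E))%E by [].
rewrite E1 (@ge0_integralD _ (measurableTypeR R) R mu _ mc (cst 1%:E) (EFin \o W)).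
- rewrite fin_numD integral_cst// [X in (_ * X)%E]mu_cell -EFinM/=.
  exact: (@integrable_fin_num _ (measurableTypeR R) R mu (@cell R 0 0) mc (EFin \o W) W_int).
- by move=> x _; rewrite lee_fin.
- exact: measurable_cst.
- by move=> x _; rewrite lee_fin.
- apply/measurable_EFinP; exact: (measurable_funS measurableT (@subsetT _ _) mW).
Qed.

(* On each cell [expR (leaf N k)] is at most the inverse of the average of the
   weight, or [1]. *)
Lemma integral_flow_le N (f : nat -> R) :
  (forall k, (k < 2 ^ N)%N -> f k <= v N k) ->
  (\int[mu]_(x in @cell R 0 0) (expR (f (cell_index N x)) * W x)%:E <= Wmass)%E.
Proof.
move=> fv; have mf : measurable_fun setT (fun x : R => expR (f (cell_index N x)) * W x).
  apply: measurable_funM; last exact: mW.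
  exact: (@measurable_step R (fun k => expR (f k)) N setT).
apply: (@integral_cells_le N).
- exact/measurable_EFinP.
- exact/measurable_EFinP.
- by move=> x; rewrite lee_fin mulr_ge0 ?expR_ge0.
- by move=> x; rewrite lee_fin addr_ge0.
move=> k kN; have mc : measurable (@cell R N k) by exact: measurable_cell.
have mWk : measurable_fun (@cell R N k) (EFin \o W).
  apply/measurable_EFinP; exact: (measurable_funS measurableT (@subsetT _ _) mW).
have -> : (\int[mu]_(x in cell N k) (expR (f (cell_index N x)) * W x)%:E =
    (expR (f k))%:E * \int[mu]_(x in cell N k) (EFin \o W) x)%E.
  rewrite -(@ge0_integralZl_EFin _ (measurableTypeR R) R mu _ mc) ?expR_ge0//.
    apply: eq_integral => x /set_mem kx.
    by rewrite (proj1 (cellP _ _ (cell_ge0 kx)) kx).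
  by move=> x _; rewrite lee_fin.
have -> : (\int[mu]_(x in cell N k) (1 + W x)%:E =
    \int[mu]_(x in cell N k) ((cst 1%:E x : \bar R) + (EFin \o W) x))%E by [].
rewrite (@ge0_integralD _ (measurableTypeR R) R mu _ mc (cst 1%:E) (EFin \o W))//; last first.
  by move=> x _; rewrite lee_fin.
rewrite integral_cst// [X in (_ <= _ * X + _)%E]mu_cell.
rewrite (cell_avg_integral W_int kN) -!EFinM -EFinD lee_fin.
have := expR_leaf b W_ge0 N k; have a0 := cell_avg_ge0 W_ge0 N k.
have ef : expR (f k) <= expR (v N k) by rewrite ler_expR fv.
have ar := arc_length_gt0 R N.
move=> hl; have hh1 : expR (f k) * cell_avg W N k <= 1 + cell_avg W N k.
  by rewrite (le_trans _ hl)// ler_wpM2r.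
rewrite mul1r mulrCA -[X in X + _]mulr1 -mulrDr.
by rewrite ler_pM2l.
Qed.

(** The flow carries mean n. Far from the endpoints of cells |p|^t is at most exp(1 - n) times the
    exponential of the flow, which the leaf bound integrates against w; near them the weight is
    negligible. *)
Lemma stage (n : nat) : exists p : {poly R[i]}, [/\
  (\int[arclength R]_(z in circle R) (normc p.[z] `^ t * w z)%:E <=
    (expR (1 - n%:R) * fine Wmass + expR (- n%:R))%:E)%E,
  forall z, normc z < 1 -> normc (p.[z] - 1) <=
    expR (n.+1%:R^-1 * (((1 - normc z) ^+ 2)^-1 + 1)) - 1 &
  forall z, normc z < 1 -> normc p.[z] <=
    expR (eps * (h (1 - normc z) / (1 - normc z)))].
Proof.
set M : R := n%:R; have M0 : 0 <= M by [].
have eps36 : 0 < eps / 36 by rewrite divr_gt0.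
(* The level must be deep enough for its cap to exceed M, so that the flow exists, and for its cells
   to be so short that the exponent is small inside the disk. *)
have [n0 Mb Ma] : exists2 n0, M < b n0 & M / t * (8 * arc n0) <= n.+1%:R^-1.
  have s0 : 0 < n.+1%:R^-1 / (8 * (M / t) + 1).
    by rewrite divr_gt0 ?invr_gt0 ?ltr0n// ltr_wpDl// mulr_ge0// divr_ge0// ltW.
  have /cvgryPgt /(_ M) nb := gauge_bound_cvg hh e_gt0.
  have /cvgrPdist_lt /(_ _ s0) na := @arc_length_cvg R.
  near \oo => l; exists l; first by near: l.
  have : `|0 - arc l| < n.+1%:R^-1 / (8 * (M / t) + 1) by near: l.
  have al := arc_length_gt0 R l.
  have Mt : 0 <= M / t by rewrite divr_ge0// ltW.
  rewrite sub0r normrN gtr0_norm// ltr_pdivlMr; last first.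
    by rewrite ltr_wpDl// mulr_ge0.
  move=> /ltW; apply: le_trans.
  have -> : arc l * (8 * (M / t) + 1) = M / t * (8 * arc l) + arc l by ring.
  by rewrite lerDl ltW.
have [D HD] := flow_capacity M0 Mb.
pose N := (n0 + D)%N.
pose F i k := flow b v n0 D M i k.
(* Division by t, undone by the power t of the modulus; 0 beyond the last cell keeps [f] bounded for
   all indices. *)
pose f k := if (k < 2 ^ N)%N then F D k / t else 0.
have F0 i k : 0 <= F i k by exact: flow_ge0.
have FvN k : (k < 2 ^ N)%N -> F D k <= v N k.
  by move=> kN; have := flow_le_cap v_ge0 v_le HD (leqnn D) kN; rewrite subnn.
pose A := b N / t.
have A0 : 0 <= A by rewrite divr_ge0// ltW.
have f_bnd k : 0 <= f k <= A.
  rewrite /f; case: ifP => kN; last by rewrite lexx A0.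
  rewrite divr_ge0 ?(ltW t_gt0)//= ler_pM2r ?invr_gt0//.
  by rewrite (le_trans (FvN _ kN)).
have fsum i k : (i <= D)%N -> (k < 2 ^ (n0 + i))%N ->
    \sum_(j < 2 ^ (D - i)) f (k * 2 ^ (D - i) + j)%N
      = (2 ^ (D - i))%:R * (F i k / t).
  move=> iD kn; rewrite (eq_bigr (fun j : 'I_(2 ^ (D - i)) => F (i + (D - i))%N (k * 2 ^ (D - i) + j)%N / t)).
    by rewrite -mulr_suml flow_block_sum// natrX mulrA.
  move=> j _; rewrite subnKC// /f ifT//.
  have -> : (2 ^ N = 2 ^ (n0 + i) * 2 ^ (D - i))%N.
    by rewrite -expnD -addnA subnKC.
  by rewrite (@leq_trans (k.+1 * 2 ^ (D - i)))// ?leq_mul2r ?kn ?orbT// mulSnr ltn_add2l.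
have f_sum k : (k < 2 ^ n0)%N ->
    \sum_(j < 2 ^ D) f (k * 2 ^ D + j)%N = (2 ^ D)%:R * (M / t).
  by move=> kn; have := fsum 0%N k (leq0n _); rewrite subn0 addn0; apply.
have f_le i k : (i <= D)%N -> (k < 2 ^ (n0 + i))%N ->
    \sum_(j < 2 ^ (D - i)) f (k * 2 ^ (D - i) + j)%N
      <= (2 ^ (D - i))%:R * gauge_bound h (eps / 36) (n0 + i).
  move=> iD kn; rewrite fsum// ler_pM2l ?pow2_gt0// ler_pdivrMr// mulrC -b_scale.
  have := flow_le_cap v_ge0 v_le HD iD kn => /le_trans; apply.
  exact: capacity_le.
(* The first bound gives convergence to 1; the second gives t eta <= 1, the source of the 1 in exp(1
   - n). *)
pose eta := Num.min n.+1%:R^-1 t^-1.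
have eta0 : 0 < eta by rewrite lt_min !invr_gt0 ltr0n t_gt0.
have eta1 : eta <= n.+1%:R^-1 by rewrite ge_min lexx.
have etat : t * eta <= 1 by rewrite mulrC -ler_pdivlMr// div1r ge_min lexx orbT.
set C := expR (t * (A + eta)).
have C0 : 0 < C by exact: expR_gt0.
(* [C] bounds |p|^t on the whole circle and does not depend on d, so d can be chosen to make the
   near part cost at most exp(-M). *)
have [d dpi dsmall] := near_weight_small N (divr_gt0 (expR_gt0 (- M)) C0).
have Mt0 : 0 <= M / t by rewrite divr_ge0// ltW.
have [p [p3 p2 pA pf]] := flow_polynomial hh eps36 Mt0 f_bnd f_sum f_le dpi eta0.
exists p; split; last 2 first.
- move=> z z1; rewrite (le_trans (p2 z z1))// lerD2r ler_expR mulrDr mulr1 lerD//.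
  by rewrite mulrA ler_wpM2r// invr_ge0 sqr_ge0.
- move=> z z1; rewrite (le_trans (p3 z z1))// ler_expR.
  by have -> : 36 * (eps / 36) = eps by field.
have mF : measurable_fun (circle R : set (borelC R)) (fun z => normc p.[z] `^ t * w z).
  apply: measurable_funM; last exact: measurable_circle_weight.
  exact: (measurable_funS measurableT (@subsetT _ _) (@measurable_normc_horner R p t)).
rewrite integral_arclength; last 3 first.
- by apply: closed_measurableC; exact: closed_circle.
- exact/measurable_EFinP.
- by move=> z zc; rewrite lee_fin mulr_ge0 ?powR_ge0// w_ge0.
have -> : @expi R @^-1` circle R `&` @cell R 0 0 = @cell R 0 0.
  by apply/seteqP; split=> [x []//|x xc]; split=> //; exact: circle_expi.
have mc : measurable (@cell R 0 0) by exact: measurable_cell.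
pose g1 (x : R) := expR (1 - M) * (expR (t * f (cell_index N x)) * W x).
pose g2 (x : R) := C * near_weight N d x.
have mg1' : measurable_fun setT (fun x : R => expR (t * f (cell_index N x)) * W x).
  apply: measurable_funM; last exact: mW.
  exact: (@measurable_step R (fun k => expR (t * f k)) N setT).
have mg1 : measurable_fun setT g1 by exact: measurable_funM.
have mg2 : measurable_fun setT g2.
  by apply: measurable_funM => //; exact: measurable_near_weight.
have nw0 x : 0 <= near_weight N d x by rewrite /near_weight; case: ifP.
have g10 x : 0 <= g1 x by rewrite !mulr_ge0 ?expR_ge0.
have g20 x : 0 <= g2 x by rewrite mulr_ge0 ?(ltW C0).
have mS G : measurable_fun setT G -> measurable_fun (@cell R 0 0) (EFin \o G).
  move=> mG; apply/measurable_EFinP; exact: (measurable_funS measurableT (@subsetT _ _) mG).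
have pe : forall x, normc p.[expi x] `^ t * w (expi x) =
    normc p.[cis x] `^ t * W x by [].
apply: (@le_trans _ _ (\int[mu]_(x in @cell R 0 0) ((EFin \o g1) x + (EFin \o g2) x))%E).
  apply: (@ge0_le_integral _ (measurableTypeR R) R mu _ mc).
  - by move=> x _; rewrite lee_fin mulr_ge0 ?powR_ge0// W_ge0.
  - have mcomp : measurable_fun (@expi R @^-1` circle R)
        (fun x => normc p.[expi x] `^ t * w (expi x)).
      have mcir : measurable (circle R : set (borelC R)).
        by apply: closed_measurableC; exact: closed_circle.
      apply: (measurable_comp mcir _ mF).
        by move=> _ [x Ax <-].
      by apply: measurable_funTS; exact: measurable_expi.
    apply: mS; have pc : @expi R @^-1` circle R = setT.
      by apply/seteqP; split => // x _; exact: circle_expi.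
    by rewrite pc in mcomp.
  - by apply: emeasurable_funD; exact: mS.
  move=> x xc; rewrite pe /= -EFinD lee_fin /g1 /g2 /near_weight.
  have iN := cell_index_lt N xc.
  case: ifP => [far|_].
    rewrite mulr0 addr0 mulrA ler_wpM2r// -expRD.
    have far' : 2 * pi * (cell_index N x)%:R / (2 ^ N)%:R + d <= x <=
        2 * pi * (cell_index N x).+1%:R / (2 ^ N)%:R - d.
      by move: far; rewrite /far_from_grid /arc_length ![_ / _ * _]mulrAC.
    have q := pf _ _ iN far'.
    apply: (@le_trans _ _ (expR (f (cell_index N x) - M / t + eta) `^ t)).
      by apply: ge0_ler_powR; rewrite ?nnegrE ?normc_ge0 ?expR_ge0 ?(ltW t_gt0).
    rewrite -expRM ler_expR.
    have -> : (f (cell_index N x) - M / t + eta) * t =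
        t * f (cell_index N x) - M + t * eta by field; rewrite gt_eqF.
    by move: etat; move: (t * eta) (t * f _) => y1 y2; lra.
  apply: (@le_trans _ _ (C * W x)); last first.
    by rewrite lerDr mulr_ge0 ?expR_ge0// mulr_ge0 ?expR_ge0// W_ge0.
  apply: ler_wpM2r; first exact: W_ge0.
  apply: (@le_trans _ _ (expR (A + eta) `^ t)).
    by apply: ge0_ler_powR; rewrite ?nnegrE ?normc_ge0 ?expR_ge0 ?(ltW t_gt0).
  by rewrite -expRM /C mulrC.
rewrite (@ge0_integralD _ (measurableTypeR R) R mu _ mc (EFin \o g1) (EFin \o g2)); first last.
- exact: mS.
- by move=> x _; rewrite lee_fin.
- exact: mS.
- by move=> x _; rewrite lee_fin.
rewrite EFinD; apply: leeD.
  rewrite (_ : (\int[mu]_(x in cell 0 0) (EFin \o g1) x)%E = ((expR (1 - M))%:E *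
     \int[mu]_(x in cell 0 0) (expR (t * f (cell_index N x)) * W x)%:E)%E); last first.
    rewrite -(@ge0_integralZl_EFin _ (measurableTypeR R) R mu _ mc) ?expR_ge0//.
    - by move=> x _; rewrite lee_fin mulr_ge0 ?expR_ge0.
    - exact: mS.
  rewrite EFinM fineK// lee_pmul2l ?lte_fin ?expR_gt0//.
  apply: (@integral_flow_le N (fun k => t * f k)) => k kN.
  by rewrite /f kN mulrCA divff ?gt_eqF// mulr1 FvN.
rewrite (_ : (\int[mu]_(x in cell 0 0) (EFin \o g2) x)%E = (C%:E *
   \int[mu]_(x in cell 0 0) (near_weight N d x)%:E)%E); last first.
  rewrite -(@ge0_integralZl_EFin _ (measurableTypeR R) R mu _ mc) ?(ltW C0)//.
  - by move=> x _; rewrite lee_fin.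
  - by apply: mS; exact: measurable_near_weight.
apply: (le_trans (lee_wpmul2l _ dsmall)); first by rewrite lee_fin ltW.
by rewrite -EFinM lee_fin mulrC divfK// gt_eqF.
Unshelve. all: by end_near. Qed.

End Assembly.

(** * Passage to the limit *)

Lemma cvg_expR_harmonic (R : realType) (q : R) :
  (fun n : nat => expR (n.+1%:R^-1 * q) - 1) @ \oo --> (0 : R).
Proof.
have cz : (fun n : nat => n.+1%:R^-1 * q) @ \oo --> (0 : R).
  rewrite -[X in _ --> X](mul0r q).
  by apply: cvgM; [exact: cvg_harmonic | exact: cvg_cst].
have cx : (fun n : nat => expR (n.+1%:R^-1 * q)) @ \oo --> expR (0 : R).
  first [ exact: (cvg_comp _ _ cz (@continuous_expR R 0))
        | exact: (continuous_cvg (@expR R) (@continuous_expR R 0) cz)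
        | apply: continuous_cvg; [exact: continuous_expR | exact: cz] ].
have e1 : 0 = expR 0 - 1 :> R by rewrite expR0 subrr.
rewrite [X in _ --> X]e1.
by apply: cvgB; [exact: cx | exact: cvg_cst].
Qed.

Unset Implicit Arguments.
Set Strict Implicit.
Set Printing Implicit Defensive.

Theorem theorem1p3 (R : realType) (h : R -> R) (w : borelC R -> R) (t eps : R)
  (hh : gauge_function h)
  (w_ge0 : forall z, circle R z -> 0 <= w z)
  (w_L1 : (arclength R).-integrable (circle R) (EFin \o w))
  (t_gt0 : 0 < t) (eps_gt0 : 0 < eps)
  (logw : forall E : set (R[i])^o, carleson_set h E ->
     (0 < arclength R E)%E ->
     (\int[arclength R]_(z in E) lne (w z)%:E)%E = -oo%E) :
  exists p : nat -> {poly R[i]},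
    [/\ (\int[arclength R]_(z in circle R)
           (Normc.normc (p N).[z] `^ t * w z)%:E)%E @[N --> \oo] --> 0%E,
        forall K : set (R[i])^o, compact K -> K `<=` disk R ->
          {uniform K, (fun (N : nat) (z : (R[i])^o) => (p N).[z] : (R[i])^o) @ \oo
                        --> (fun _ : (R[i])^o => 1 : (R[i])^o)} &
        forall (N : nat) (z : (R[i])^o), disk R z ->
          Normc.normc (p N).[z]
            <= expR (eps * (h (1 - Normc.normc z) / (1 - Normc.normc z)))].
Proof.
have [p Hp] := choice (stage hh w_ge0 w_L1 t_gt0 eps_gt0 logw).
have inv0 : (n.+1%:R^-1 : R) @[n --> \oo] --> 0 by exact: cvg_harmonic.
exists p; split.
- have eN : expR (- n%:R : R) @[n --> \oo] --> 0 by exact: cvgn_expR.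
  set K := fine (\int[@lebesgue_measure R]_(x in @cell R 0 0)
    (1 + circle_weight w x)%:E)%E.
  have cv : (expR (1 - n%:R) * K + expR (- n%:R) : R) @[n --> \oo] --> 0.
    have -> : (fun n : nat => expR (1 - n%:R) * K + expR (- n%:R) : R) =
        (fun n : nat => expR (- n%:R) * (expR 1 * K + 1)).
      by apply: funext => n; rewrite addrC expRD; ring.
    rewrite -[X in _ --> X](mul0r (expR 1 * K + 1)).
    by apply: cvgM => //; exact: cvg_cst.
  have cvE : (expR (1 - n%:R) * K + expR (- n%:R) : R)%:E @[n --> \oo] --> 0%E.
    by apply: cvg_EFin => //; exact: nearW.
  apply: (@squeeze_cvge _ _ _ _ (cst 0%E) _
    (fun n : nat => (expR (1 - n%:R) * K + expR (- n%:R) : R)%:E)) => //.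
    apply: nearW => n; have [h1 _ _] := Hp n; rewrite h1 andbT.
    apply: integral_ge0 => z zc; rewrite lee_fin mulr_ge0 ?powR_ge0//.
    exact: w_ge0.
  exact: cvg_cst.
- move=> K cK KD P /uniform_nbhs [E [entE EP]].
  move: entE; rewrite -entourage_ballE => -[c /= c0 cE].
  have cR : c = (complex.Re c)%:C by apply/esym/RRe_real/gtr0_real.
  have rc0 : 0 < complex.Re c by move: c0; rewrite {1}cR ltcR.
  (* Compactness reduces uniformity to a neighbourhood of each x in K: there |z| <= rho = (1 +
     |x|)/2 < 1, and the bound on |p - 1| increases with |z|. *)
  have near_K : near_covering K by apply/compact_near_coveringP.
  have : \forall n \near \oo, K `<=` (fun z => E (1 : (R[i])^o, (p n).[z] : (R[i])^o)).
    apply: (near_K nat \oo (fun n z => E (1 : (R[i])^o, (p n).[z] : (R[i])^o))) => x Kx.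
    have x1 : normc x < 1 := KD _ Kx.
    set rho := (1 + normc x) / 2.
    have rho1 : 0 < 1 - rho by rewrite /rho; lra.
    set q := ((1 - rho) ^+ 2)^-1 + 1.
    have q0 : 0 < q by rewrite ltr_wpDl// invr_ge0 sqr_ge0.
    have cvq := cvg_expR_harmonic q.
    move/cvgrPdist_lt : cvq => /(_ _ rc0) near_n.
    exists ([set z | normc ((x : R[i]) - z) < (1 - normc x) / 2], [set n |
        `|0 - (expR (n.+1%:R^-1 * q) - 1)| < complex.Re c]).
      split => //=; exists ((1 - normc x) / 2)%:C.
        by rewrite /= ltcR; lra.
      by move=> z; rewrite /ball_/= -ltcR.
    move=> [z n] /= [xz nc]; apply: cE => /=.
    have zrho : normc z <= rho.
      have := normc_distr_ge z x; rewrite normcB_sym /rho; lra.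
    have z1 : normc z < 1 by lra.
    have [_ h2 _] := Hp n.
    rewrite /ball /= /ball_ cR -[ltLHS]/((normc (1 - (p n).[z]))%:C) ltcR normcB_sym.
    apply: (le_lt_trans (h2 z z1)); apply: le_lt_trans nc.
    rewrite sub0r normrN (le_trans _ (ler_norm _))// lerD2r ler_expR.
    rewrite ler_wpM2l ?invr_ge0 ?ler0n// lerD2r.
    have zr : 1 - rho <= 1 - normc z by rewrite lerB.
    rewrite lef_pV2 ?posrE ?exprn_gt0//; first by rewrite lerXn2r ?nnegrE ?(ltW rho1) ?subr_ge0 ?(ltW z1).
    by rewrite (lt_le_trans rho1).
  by apply: filterS => n Kn; apply: EP => z Kz; exact: Kn.
- by move=> N z zd; have [_ _ h3] := Hp N; exact: h3.
Qed.
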